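(* Let $Y$ be a compact space and let $P(y,\varphi)=\exp(-2\pi i\varphi)X_1(y)^*+X_0(y)+\exp(2\pi i\varphi)X_1(y)$ be a non-trivial rank 1 Rieffel projection in $M_2(C(Y\times S^1))$. Then there exists a function $f:Y\to[0,1]$, continuous on $supp(X_1)$ and vanishing elsewhere, such that: (1) $X_0\ell_{X_1}=f\ell_{X_1}$; (2) $\exp(2\pi i f)\in C(Y)$; (3) $\partial_0[P]$ is the class of the unitary $(1-\ell_{X_1})+\exp(2\pi i f)\ell_{X_1}$ in $K_1(C(Y))$; (4) if $supp(X_1)$ is contractible, then $\partial_0[P]=[\exp(2\pi i f)]$ in $K_1(C(Y))$.
   Context: $C(Y)$ denotes the algebra of continuous complex-valued functions on $Y$. Points of $S^1$ are written $\exp(2\pi i\varphi)$, $\varphi\in[0,1]$. A Rieffel projection in $M_2(C(Y\times S^1))$ is a projection $P$ ($P=P^*=P^2$) of the form $P(y,\varphi)=\exp(-2\pi i\varphi)X_1(y)^*+X_0(y)+\exp(2\pi i\varphi)X_1(y)$ with $X_0,X_1\in M_2(C(Y))$ and $X_0=X_0^*$. It is non-trivial if $X_1\neq0$, and has rank 1 if $P(y,\varphi)$ has rank 1 for every $(y,\varphi)$. For $y\in Y$, $\ell_{X_1}(y)\in M_2(\mathbb{C})$ denotes the orthogonal projection on the range of $X_1(y)$ (so $\ell_{X_1}(y)=0$ if $X_1(y)=0$), and $supp(X_1)=\{y\in Y: X_1(y)\neq 0\}$ (no closure is taken). Equalities involving $\ell_{X_1}$ are pointwise on $Y$. $\partial_0$: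 for a unital $C^*$-algebra $A$ and a $*$-automorphism $\alpha$, the crossed product $A\rtimes_\alpha\mathbb{Z}$ is the universal $C^*$-algebra generated by $A$ and a unitary $u$ with $u^*au=\alpha(a)$ for all $a\in A$; $\partial_0:K_0(A\rtimes_\alpha\mathbb{Z})\to K_1(A)$ is the boundary map of the Pimsner-Voiculescu six-term exact sequence. Its sign convention is that of Pimsner and Voiculescu, for which every projection of the form $p=u^*x_1^*+x_0+x_1u$, with $x_0=x_0^*$ and $x_1$ in $A$ (or in a matrix algebra over $A$), satisfies $\partial_0[p]=[\exp(2\pi i x_0\ell_{x_1})]$, where $\ell_{x_1}$ is the left support projection of $x_1$ in the enveloping von Neumann algebra. Here it is used for the trivial action on $A=C(Y)$, with $C(Y\times S^1)=C(Y)\otimes C(S^1)=C(Y)\rtimes_{Id}\mathbb{Z}$ and $u$ the function $(y,\varphi)\mapsto\exp(2\pi i\varphi)$. In this case $\partial_0:K_0(C(Y\times S^1))\to K_1(C(Y))$ is the projection onto the second summand in $K_0(C(Y\times S^1))\cong K_0(C(Y))\oplus K_1(C(Y))$. *)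

(* Defs.v *)
(* Complex numbers are R[i] over R : realType; R[i]^o carries their usual
   topology. *)
From HB Require Import structures.
From mathcomp Require Import all_boot all_order all_algebra.
From mathcomp Require Import complex.
From mathcomp Require Import all_classical all_reals all_analysis.

Set Implicit Arguments.
Unset Strict Implicit.
Unset Printing Implicit Defensive.

Import Order.TTheory GRing.Theory Num.Theory.
Import numFieldNormedType.Exports.

Local Open Scope classical_set_scope.
Local Open Scope ring_scope.
Local Open Scope complex_scope.
Local Open Scope sesquilinear_scope.

Definition expi2pi (R : realType) (t : R) : R[i] :=
  cos (2 * pi * t) +i* sin (2 * pi * t).

Definition circle (R : realType) : topologicalType :=
  set_type [set z : R[i]^o | `|z| = 1].

Definition unit_interval (R : realType) : topologicalType :=
  set_type `[0 : R, 1]%classic.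

Definition contractible (R : realType) (T : topologicalType) : Prop :=
  exists (c : T) (H : T * unit_interval R -> T), continuous H /\
    forall x t, (set_val t = 0 -> H (x, t) = x) /\ (set_val t = 1 -> H (x, t) = c).

(* For a topological space X, M_(m,n)(C(X)) is the set of maps A : X -> 'M_(m,n)
   with mx_continuous A. *)
Definition mx_continuous (R : realType) (X : topologicalType) (m n : nat)
    (A : X -> 'M[R[i]]_(m, n)) : Prop :=
  forall i j, continuous (fun x => A x i j : R[i]^o).

Definition is_projection_over (R : realType) (X : topologicalType) (n : nat)
    (p : X -> 'M[R[i]]_n) : Prop :=
  mx_continuous p /\ forall x, (p x)^t* = p x /\ p x *m p x = p x.

Definition is_unitary_over (R : realType) (X : topologicalType) (n : nat)
    (u : X -> 'M[R[i]]_n) : Prop :=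
  mx_continuous u /\ forall x, u x \is unitarymx.

Definition dsum (R : realType) (m n : nat) (A : 'M[R[i]]_m) (B : 'M[R[i]]_n) :
  'M[R[i]]_(m + n) := block_mx A 0 0 B.

Definition castsq (R : realType) (m n : nat) (e : m = n) (A : 'M[R[i]]_m) :
  'M[R[i]]_n := castmx (e, e) A.

Record projection_over (R : realType) (X : topologicalType) := ProjectionOver {
  psize : nat;
  pmx :> X -> 'M[R[i]]_psize;
  pmxP : is_projection_over pmx }.

Record unitary_over (R : realType) (X : topologicalType) := UnitaryOver {
  usize : nat;
  umx :> X -> 'M[R[i]]_usize;
  umxP : is_unitary_over umx }.

Definition murray_von_neumann (R : realType) (X : topologicalType) (m n : nat)
    (p : X -> 'M[R[i]]_m) (q : X -> 'M[R[i]]_n) : Prop :=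
  exists v : X -> 'M[R[i]]_(n, m), mx_continuous v /\
    forall x, (v x)^t* *m v x = p x /\ v x *m (v x)^t* = q x.

(* A pair (p, q) stands for the formal difference [p] - [q]. *)
Definition K0_eq (R : realType) (X : topologicalType)
    (a b : projection_over R X * projection_over R X) : Prop :=
  exists r : projection_over R X,
    murray_von_neumann
      (fun x => dsum (dsum (a.1 x) (b.2 x)) (r x))
      (fun x => dsum (dsum (b.1 x) (a.2 x)) (r x)).

Definition K0 (R : realType) (X : topologicalType) : Type :=
  {c : set (projection_over R X * projection_over R X) |
    exists a, c = [set b | K0_eq a b]}.

Definition K0_diff (R : realType) (X : topologicalType)
    (p q : projection_over R X) : K0 R X :=
  exist _ [set b | K0_eq (p, q) b] (ex_intro _ (p, q) erefl).

Lemma is_projection_over0 (R : realType) (X : topologicalType) :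
  is_projection_over (fun _ : X => 0 : 'M[R[i]]_0).
Proof. by split=> [[]|x] //; split; apply/matrixP => -[]. Qed.

Definition K0_class (R : realType) (X : topologicalType)
    (p : projection_over R X) : K0 R X :=
  K0_diff p (ProjectionOver (is_projection_over0 R X)).

(* Equality in K_1: homotopy of unitaries after adding identity blocks.  A
   unitary over C(X x [0,1]) is a norm-continuous path of unitaries over C(X),
   X being compact. *)
Definition K1_eq (R : realType) (X : topologicalType)
    (u v : unitary_over R X) : Prop :=
  exists (k l : nat) (e : (usize u + k = usize v + l)%N)
         (h : X * unit_interval R -> 'M[R[i]]_(usize v + l)),
    is_unitary_over h /\ forall x t,
      (set_val t = 0 -> h (x, t) = castsq e (dsum (u x) 1%:M)) /\
      (set_val t = 1 -> h (x, t) = dsum (v x) 1%:M).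

Definition K1 (R : realType) (X : topologicalType) : Type :=
  {c : set (unitary_over R X) | exists u, c = [set v | K1_eq u v]}.

Definition K1_class (R : realType) (X : topologicalType)
    (u : unitary_over R X) : K1 R X :=
  exist _ [set v | K1_eq u v] (ex_intro _ u erefl).

(* An operator a on l^2(nat) (x) C^n is given by its matrix of blocks: a i j is the
   component from the j-th to the i-th copy of C^n.  Boundedness is not part of
   the type. *)
Definition op (R : realType) (n : nat) : Type := nat -> nat -> 'M[R[i]]_n.

Definition op1 (R : realType) (n : nat) : op R n :=
  fun i j => if i == j then 1%:M else 0.

Definition op_sub (R : realType) (n : nat) (a b : op R n) : op R n :=
  fun i j => a i j - b i j.

Definition op_adj (R : realType) (n : nat) (a : op R n) : op R n :=
  fun i j => (a j i)^t*.

(* The series converge when a and b are bounded. *)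
Definition op_mul (R : realType) (n : nat) (a b : op R n) : op R n :=
  fun i j => \matrix_(s, t)
    lim ((fun N => (\sum_(k < N) a i k *m b k j) s t : R[i]^o) @ \oo).

(* exp(2 pi i a), by its power series; it converges when a is bounded. *)
Definition op_exp2pii (R : realType) (n : nat) (a : op R n) : op R n :=
  fun i j => \matrix_(s, t)
    lim ((fun N => \sum_(m < N) ((2 * pi)%:C * 'i%C) ^+ m / (m`!)%:R
                     * iter m (op_mul a) (op1 R n) i j s t : R[i]^o) @ \oo).

Definition sqnorm (R : realType) (n : nat) (v : 'cV[R[i]]_n) : R[i] :=
  \sum_(k < n) `|v k 0| ^+ 2.

(* For c >= 0: the operator norm of a is at most c, i.e. all the compressions of
   a to the first N coordinates have norm at most c. *)
Definition op_norm_le (R : realType) (n : nat) (a : op R n) (c : R) : Prop :=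
  forall (N : nat) (v : nat -> 'cV[R[i]]_n),
    \sum_(i < N) sqnorm (\sum_(j < N) a i j *m v j)
      <= (c ^+ 2)%:C * \sum_(j < N) sqnorm (v j).

Definition op_cut (R : realType) (n : nat) (N : nat) (a : op R n) : op R n :=
  fun i j => if (i < N)%N && (j < N)%N then a i j else 0.

Definition op_continuous (R : realType) (X : topologicalType) (n : nat)
    (a : X -> op R n) : Prop :=
  forall (x : X) (eps : R), 0 < eps ->
    \forall x' \near x, op_norm_le (op_sub (a x') (a x)) eps.

(* M_n(C(X, K)), that is M_n(C(X) (x) K) for X compact, where K is the algebra of
   compact operators on l^2(nat): an operator is compact iff it is the norm limit
   of its finite compressions. *)
Definition compact_field (R : realType) (X : topologicalType) (n : nat)
    (a : X -> op R n) : Prop :=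
  op_continuous a /\
  forall (x : X) (eps : R), 0 < eps ->
    exists N, op_norm_le (op_sub (a x) (op_cut N (a x))) eps.

(* Unitaries of 1 + M_n(C(X) (x) K). *)
Definition is_compact_unitary (R : realType) (X : topologicalType) (n : nat)
    (w : X -> op R n) : Prop :=
  compact_field (fun x => op_sub (w x) (op1 R n)) /\
  forall x, op_mul (w x) (op_adj (w x)) = op1 R n /\
            op_mul (op_adj (w x)) (w x) = op1 R n.

Definition op_dsum (R : realType) (m n : nat) (a : op R m) (b : op R n) :
  op R (m + n) := fun i j => dsum (a i j) (b i j).

(* [w] = [w'] in K_1(C(X) (x) K), for X compact. *)
Definition K1_compact_eq (R : realType) (X : topologicalType) (m n : nat)
    (w : X -> op R m) (w' : X -> op R n) : Prop :=
  exists (k l : nat) (e : (m + k = n + l)%N)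
         (h : X * unit_interval R -> op R (n + l)),
    is_compact_unitary h /\ forall x t i j,
      (set_val t = 0 -> h (x, t) i j = castsq e (op_dsum (w x) (op1 R k) i j)) /\
      (set_val t = 1 -> h (x, t) i j = op_dsum (w' x) (op1 R l) i j).

(* 1 + (u - 1) (x) e_00.  On unitaries over C(X) this induces the stability
   isomorphism K_1(C(X)) = K_1(C(X) (x) K). *)
Definition corner (R : realType) (n : nat) (u : 'M[R[i]]_n) : op R n :=
  fun i j => if (i == 0)%N && (j == 0)%N then u else op1 R n i j.

(* With S the unilateral shift, S delta_j = delta_(j+1), and S^(-k) read as
   (S^* )^k, toeplitz c is the sum of the c_k (x) S^k. *)
Definition toeplitz (R : realType) (n : nat) (c : int -> 'M[R[i]]_n) : op R n :=
  fun i j => c (i%:Z - j%:Z).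

(* The sum of the z^k c_k over -N <= k <= N. *)
Definition trigpoly (R : realType) (n : nat) (N : nat) (c : int -> 'M[R[i]]_n)
    (z : R[i]) : 'M[R[i]]_n :=
  \sum_(k < N.*2.+1) z ^ (k%:Z - N%:Z) *: c (k%:Z - N%:Z).

(* Pimsner and Voiculescu use the Toeplitz extension
     0 -> C(Y) (x) K -> C(Y) (x) T -> C(Y x S^1) -> 0
   (trivial action), T the C*-algebra generated by S, where S is mapped to the
   function u(y, z) = z.  toeplitz_lift a p says that a is in M_n(C(Y) (x) T)
   and is mapped to p: a is a norm limit of operators T_Q + F, with F compact and
   Q trigonometric polynomials converging uniformly to p. *)
Definition toeplitz_lift (R : realType) (Y : topologicalType) (n : nat)
    (a : Y -> op R n) (p : Y * circle R -> 'M[R[i]]_n) : Prop :=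
  forall eps : R, 0 < eps ->
    exists (N : nat) (c : int -> Y -> 'M[R[i]]_n) (F : Y -> op R n),
      [/\ forall k, mx_continuous (c k),
          forall k y, (N < `|k|)%N -> c k y = 0,
          compact_field F,
          forall y z s t,
            `|trigpoly N (c^~ y) (set_val z) s t - p (y, z) s t| <= eps%:C
        & forall y,
            op_norm_le (op_sub (op_sub (a y) (toeplitz (c^~ y))) (F y)) eps].

Definition selfadjoint_lift (R : realType) (Y : topologicalType) (n : nat)
    (a : Y -> op R n) (p : Y * circle R -> 'M[R[i]]_n) : Prop :=
  toeplitz_lift a p /\ forall y, op_adj (a y) = a y.

(* PV_boundary x z is the equality d_0(x) = z.  The boundary map d_0 is the
   connecting (exponential) map K_0(C(Y x S^1)) -> K_1(C(Y) (x) K) of the Toeplitz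
   extension, [p] |-> [exp(2 pi i a)] for a self-adjoint lift a of p, followed by
   the inverse of the stability isomorphism; so d_0([p] - [q]) = [u] means
   [exp(2 pi i a)] = [exp(2 pi i b)] + [corner u] in K_1(C(Y) (x) K).  That the
   result depends only on x is the well-definedness of the connecting map.

   Sign: for a Rieffel projection p = u^* x1^* + x0 + x1 u, the lift
   a = S^* x1^* + x0 + x1 S satisfies a^2 = a - x1 x1^* (x) e_00, whence
   exp(2 pi i a) = corner (exp(2 pi i x0 l)), l the left support of x1.
   This is the sign of Pimsner and Voiculescu; mapping S to u^* instead would
   give the opposite one. *)
Definition PV_boundary (R : realType) (Y : topologicalType)
    (x : K0 R (Y * circle R)%type) (z : K1 R Y) : Prop :=
  exists (p q : projection_over R (Y * circle R)%type) (u : unitary_over R Y)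
         (a : Y -> op R (psize p)) (b : Y -> op R (psize q)),
    [/\ x = K0_diff p q, z = K1_class u,
        selfadjoint_lift a p, selfadjoint_lift b q
      & K1_compact_eq (fun y => op_exp2pii (a y))
          (fun y => op_dsum (op_exp2pii (b y)) (corner (u y)))].

Definition rieffel (R : realType) (Y : topologicalType) (n : nat)
    (X0 X1 : Y -> 'M[R[i]]_n) (yz : Y * circle R) : 'M[R[i]]_n :=
  let z : R[i] := set_val yz.2 in
  z^* *: (X1 yz.1)^t* + X0 yz.1 + z *: X1 yz.1.

(* proj_ortho acts on row vectors, from the right: transposing twice gives the
   orthogonal projection of column vectors onto the range of A. *)
Definition left_support (R : realType) (n : nat) (A : 'M[R[i]]_n) : 'M[R[i]]_n :=
  (proj_ortho A^T)^T.

Definition mx_supp (R : realType) (Y : topologicalType) (n : nat)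
    (A : Y -> 'M[R[i]]_n) : set Y := [set y | A y != 0].

(* Main.v *)
Require Import Defs.
From HB Require Import structures.
From mathcomp Require Import all_boot all_order all_algebra.
From mathcomp Require Import complex.
From mathcomp Require Import all_classical all_reals all_analysis.
From mathcomp Require Import ring lra zify.
Import Order.TTheory GRing.Theory Num.Theory.
Import numFieldNormedType.Exports.
Local Open Scope classical_set_scope.
Local Open Scope ring_scope.
Local Open Scope complex_scope.
Local Open Scope sesquilinear_scope.

Set Implicit Arguments.
Unset Strict Implicit.
Unset Printing Implicit Defensive.

(** Fix a point of Y and compare Fourier coefficients in P^2 = P.  This gives
    X1^2 = 0, X0 X1 + X1 X0 = X1 and X0^2 + X1 X1' + X1' X1 = X0, where the
    prime is the adjoint ([rieffel_relations]).  A square-zero 2 x 2 matrix has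
    trace 0, hence X1 X1' + X1' X1 is the scalar tau = tr (X1 X1')
    ([sq0_anticommutator]), and where X1 does not vanish its left support is
    l = X1 X1' / tau.  The second relation says that X0 maps the range of X1
    into itself, so X0 l = f l with f = tr (X0 l), and the third one, multiplied
    by l, says f - f^2 = tau ([eigenvalue_frob2]).  Thus 0 <= f <= 1, and f is
    close to 0 or to 1 when X1 is small.  More precisely
    cos (2 pi f) = - cos (pi sqrt (1 - 4 tau)) is a continuous function of tau,
    equal to 1 where tau = 0, which makes exp (2 pi i f) continuous on all of Y
    although f need not be ([expi2pi_eigenvalue_continuous]).  For the same
    reason 1 - l + exp (2 pi i f) l is continuous: l is bounded, and its
    coefficient exp (2 pi i f) - 1 tends to 0 wherever l may jump
    ([pinched_unitary]).

    For the boundary map, take the self-adjoint lift a = S' X1' + X0 + X1 S of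
    P, S being the shift.  Write E for l placed in the corner (0, 0).  Then
    a E = f E and a^2 = a - (f - f^2) E, so that a = f E + Q with Q a projection
    orthogonal to E.  Therefore exp (2 pi i a) = 1 - E + exp (2 pi i f) E, an
    equality rather than a homotopy ([exp_rieffel_op]); a homotopy of unitaries
    over C(Y) induces one in the corner ([K1_corner]).

    When the support U of X1 is contracted to a point c by H, the line bundle
    ran l over U need not be trivialised.  It is enough to move the projection:
    1 - l(H(y, t)) + exp (2 pi i f(y)) l(H(y, t)), extended by 1 off U, is a
    path of unitaries over C(Y), again because its coefficient vanishes off U.
    At its end l(c) is a constant rank-one projection.  Conjugating at the same
    time by a path in U(2) that takes l(c) to the first coordinate projection
    ([rank1_projection_rotation]) makes the end equal to diag (exp (2 pi i f), 1)
    ([K1_eq_contractible_supp]). *)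

(** * Square-zero matrices of size 2 *)

Lemma conjcE (R : rcfType) (z : R[i]) : conjc z = Num.conj z.
Proof. by []. Qed.

Section SquareZero.
Variable C : numClosedFieldType.
Implicit Types A M X : 'M[C]_2.

Lemma mulmx2E m n (A : 'M[C]_(m, 2)) (B : 'M[C]_(2, n)) i j :
  (A *m B) i j = A i 0 * B 0 j + A i 1 * B 1 j.
Proof.
rewrite mxE !big_ord_recl big_ord0 addr0; congr (_ + A i _ * B _ j);
exact/val_inj.
Qed.

Lemma mxtrace2 A : \tr A = A 0 0 + A 1 1.
Proof.
by rewrite /mxtrace !big_ord_recl big_ord0 addr0; congr (_ + A _ _); exact/val_inj.
Qed.

Lemma matrix2P A M :
  A 0 0 = M 0 0 -> A 0 1 = M 0 1 -> A 1 0 = M 1 0 -> A 1 1 = M 1 1 -> A = M.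
Proof.
have I2 (i : 'I_2) : i = 0 \/ i = 1.
  by case: i => [[|[|//]] hi]; [left|right]; exact/val_inj.
move=> corner_block e01 e10 e11; apply/matrixP => i j.
by case: (I2 i) => ->; case: (I2 j) => ->.
Qed.

Lemma sq0_det A : A *m A = 0 -> \det A = 0.
Proof.
by move/(congr1 determinant); rewrite det_mulmx det0 => /eqP; rewrite mulf_eq0 orbb => /eqP.
Qed.

Lemma det2 A : \det A = A 0 0 * A 1 1 - A 0 1 * A 1 0.
Proof.
rewrite (expand_det_row _ 0) !big_ord_recl big_ord0 addr0 /cofactor !det_mx11 !mxE.
have e1 : lift (0 : 'I_2) (0 : 'I_1) = 1 by exact/val_inj.
have e0 : lift (1 : 'I_2) (0 : 'I_1) = 0 by exact/val_inj.
by rewrite (ord1 ord0) e1 e0 /= expr0 expr1; ring.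
Qed.

(** The trace of A^2 is (tr A)^2 - 2 det A, and det A = 0. *)
Lemma sq0_trace A : A *m A = 0 -> \tr A = 0.
Proof.
move=> A20; have hdet := sq0_det A20; apply/eqP; rewrite -[_ == 0]orbb -mulf_eq0.
move: A20 => /(congr1 mxtrace); rewrite mxtrace0 (mxtrace2 (_ *m _)) !mulmx2E => A20.
rewrite det2 in hdet; rewrite mxtrace2; apply/eqP.
transitivity ((A 0 0 * A 0 0 + A 0 1 * A 1 0 + (A 1 0 * A 0 1 + A 1 1 * A 1 1))
   + 2 * (A 0 0 * A 1 1 - A 0 1 * A 1 0)); first by ring.
by rewrite A20 hdet; ring.
Qed.

(** The square of the Frobenius norm. *)
Definition frob2 (X : 'M[C]_2) : C := \tr (X *m X^t*).

(** For a traceless X the off-diagonal entries of the two products cancel and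
    the diagonal ones add up to the same number. *)
Lemma sq0_anticommutator X : X *m X = 0 -> X *m X^t* + X^t* *m X = (frob2 X)%:M.
Proof.
move=> /sq0_trace; rewrite mxtrace2 => /eqP; rewrite addrC addr_eq0 => /eqP trX.
have e : (1 == 0 :> 'I_2) = false by [].
have e' : (0 == 1 :> 'I_2) = false by [].
by apply: matrix2P; rewrite /frob2 mxtrace2 [LHS]mxE [RHS]mxE !mulmx2E !mxE
  ?e ?e' ?eqxx ?mulr1n ?mulr0n trX ?rmorphN /=; ring.
Qed.

Lemma sq0_adj X : X *m X = 0 -> X^t* *m X^t* = 0.
Proof. by move=> X20; rewrite -map_mxM -trmx_mul X20 trmx0 map_mx0. Qed.

Lemma sq0_mul3 X : X *m X = 0 -> X *m X^t* *m X = frob2 X *: X.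
Proof.
move=> X20; have /(congr1 (fun M => M *m X)) := sq0_anticommutator X20.
by rewrite /= mulmxDl -[X^t* *m X *m X]mulmxA X20 mulmx0 addr0 mul_scalar_mx.
Qed.

Lemma sq0_mul3_adj X : X *m X = 0 -> X^t* *m X *m X^t* = frob2 X *: X^t*.
Proof.
move=> X20; have /(congr1 (fun M => X^t* *m M)) := sq0_anticommutator X20.
by rewrite mulmxDr !mulmxA sq0_adj // mul0mx addr0 mul_mx_scalar.
Qed.

(** By Cayley-Hamilton, A M A - tr (M A) A = - det A adj M for matrices of
    size 2.  This is how a rank-one projection compresses M to a scalar. *)
Lemma det0_sandwich A M : \det A = 0 -> A *m M *m A = \tr (M *m A) *: A.
Proof.
rewrite det2 mxtrace2 => detA; apply: matrix2P; rewrite [RHS]mxE !mulmx2E.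
all: apply/eqP; rewrite -subr_eq0; apply/eqP.
- transitivity (- (A 0 0 * A 1 1 - A 0 1 * A 1 0) * M 1 1); first by ring.
  by rewrite detA; ring.
- transitivity ((A 0 0 * A 1 1 - A 0 1 * A 1 0) * M 0 1); first by ring.
  by rewrite detA; ring.
- transitivity ((A 0 0 * A 1 1 - A 0 1 * A 1 0) * M 1 0); first by ring.
  by rewrite detA; ring.
- transitivity (- (A 0 0 * A 1 1 - A 0 1 * A 1 0) * M 0 0); first by ring.
  by rewrite detA; ring.
Qed.

Lemma frob2E X : frob2 X = `|X 0 0| ^+ 2 + `|X 0 1| ^+ 2 + `|X 1 0| ^+ 2 + `|X 1 1| ^+ 2.
Proof. by rewrite /frob2 mxtrace2 !mulmx2E !mxE !normCK; ring. Qed.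

Lemma frob2_ge0 X : 0 <= frob2 X.
Proof. by rewrite frob2E !addr_ge0 ?exprn_ge0. Qed.

Lemma frob2_eq0 X : (frob2 X == 0) = (X == 0).
Proof.
apply/idP/eqP => [|->]; last by rewrite /frob2 mul0mx mxtrace0.
rewrite frob2E !paddr_eq0 ?addr_ge0 ?exprn_ge0 // !sqrf_eq0 !normr_eq0.
by move=> /andP[/andP[/andP[/eqP ? /eqP ?] /eqP ?] /eqP ?]; apply: matrix2P; rewrite mxE.
Qed.

End SquareZero.

(** * The left support projection *)

(** When t is nonzero, the hypothesis makes A^t* a multiple of a partial
    isometry, so A A^t* / t is the orthogonal projection onto the range of A. *)
Lemma left_supportE (R : realType) n (A : 'M[R[i]]_n) (t : R[i]) :
  t != 0 -> A^t* *m A *m A^t* = t *: A^t* -> left_support A = t^-1 *: (A *m A^t*).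
Proof.
move=> t0 AAA; rewrite /left_support -[RHS]trmxK; congr (_^T).
set M := (t^-1 *: (A *m A^t*))^T; rewrite -[LHS]mul1mx -{1}(subrK M 1%:M) mulmxDl.
rewrite [X in X + _]proj_ortho_0 ?add0r.
  apply: proj_ortho_id.
  by rewrite /M linearZ /= trmx_mul scalemx_sub ?submxMl.
apply/orthomx1P; rewrite mulmxBl mul1mx; apply/eqP; rewrite subr_eq0; apply/eqP.
apply: trmx_inj; rewrite trmx_mul /M trmxK.
by rewrite -map_trmx trmxK map_trmx -scalemxAr mulmxA AAA scalerA mulVf // scale1r.
Qed.

Lemma left_support0 (R : realType) n : left_support (0 : 'M[R[i]]_n) = 0.
Proof.
apply/trmx_inj; rewrite /left_support trmxK !trmx0.
by apply/eqP; rewrite -submx0 -[X in (X <= _)%MS]mul1mx proj_ortho_sub.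
Qed.

(** * Fourier coefficients of a Rieffel projection *)

(** Five points of the circle suffice.  At the fourth roots of unity z^2 and
    z^-2 agree, which leaves a + e = 0 as the only information on a and e; one
    more point, whose square is not real, separates them. *)
Lemma trigpoly2_eq0 (C : numClosedFieldType) (a b c d e : C) :
  (forall z : C, `|z| = 1 ->
     Num.conj z ^+ 2 * a + Num.conj z * b + c + z * d + z ^+ 2 * e = 0) ->
  [/\ b = 0, c = 0, d = 0 & e = 0].
Proof.
move=> h.
pose I : C := 'i%R; have I0 : I != 0 by exact: neq0Ci.
have h1 : a + b + c + d + e = 0.
  by rewrite -[RHS](h 1 (normr1 _)) rmorph1 !expr1n !mul1r.
have hN1 : a - b + c - d + e = 0.
  by rewrite -[RHS](h (-1)) ?normrN ?normr1 // rmorphN rmorph1 sqrrN expr1n !mul1r !mulN1r.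
have hi : - a - I * b + c + I * d - e = 0.
  by rewrite -[RHS](h I (normCi _)) conjCi sqrrN sqrCi !mulN1r mulNr.
have hNi : - a + I * b + c - I * d - e = 0.
  rewrite -[RHS](h (- I)) ?normrN ?normCi // rmorphN /= conjCi opprK sqrrN.
  by rewrite sqrCi !mulN1r mulNr.
have nz n : (n.+1%:R == 0 :> C) = false by rewrite pnatr_eq0.
have c0 : c = 0.
  have : 4 * c = 0.
    transitivity ((a + b + c + d + e) + (a - b + c - d + e)
      + (- a - I * b + c + I * d - e) + (- a + I * b + c - I * d - e)); first by ring.
    by rewrite h1 hN1 hi hNi !addr0.
  by move/eqP; rewrite mulf_eq0 nz => /eqP.
have bd : b + d = 0.
  have : 2 * (b + d) = 0.
    transitivity ((a + b + c + d + e) - (a - b + c - d + e)); first by ring.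
    by rewrite h1 hN1 subr0.
  by move/eqP; rewrite mulf_eq0 nz => /eqP.
have bd' : d - b = 0.
  have : 2 * I * (d - b) = 0.
    transitivity ((- a - I * b + c + I * d - e) - (- a + I * b + c - I * d - e)).
      by ring.
    by rewrite hi hNi subr0.
  by move/eqP; rewrite !mulf_eq0 nz (negPf I0) => /eqP.
have d0 : d = 0.
  have : 2 * d = 0.
    transitivity ((b + d) + (d - b)); first by ring.
    by rewrite bd bd' addr0.
  by move/eqP; rewrite mulf_eq0 nz => /eqP.
have b0 : b = 0 by rewrite d0 addr0 in bd.
have ae : a = - e by rewrite b0 c0 d0 !addr0 in h1; apply/eqP; rewrite -addr_eq0 h1.
split=> //.
(* A Pythagorean triple gives a fifth point with rational coordinates. *)
pose z : C := (3 + 4 * I) / 5.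
have zc : Num.conj z = (3 - 4 * I) / 5.
  by rewrite /z rmorphM rmorphD rmorphM fmorphV !rmorph_nat /= conjCi mulrN.
have z1 : `|z| = 1.
  apply/eqP; rewrite -(@eqrXn2 _ 2) ?normr_ge0 // expr1n normCK zc /z; apply/eqP.
  have i2 : I ^+ 2 = -1 := sqrCi C.
  transitivity ((9 - 16 * I ^+ 2) / 25 : C); first by field.
  by rewrite i2; field.
have := h z z1; rewrite b0 c0 d0 ae zc => hz.
have : (48 / 25 * I) * e = 0.
  by rewrite -hz /z; field.
by move/eqP; rewrite !mulf_eq0 invr_eq0 !nz (negPf I0) => /eqP.
Qed.

Lemma rieffel_relations (C : numClosedFieldType) (n : nat) (X0 X1 : 'M[C]_n) :
  (forall z : C, `|z| = 1 ->
    let P := Num.conj z *: X1^t* + X0 + z *: X1 in P *m P = P) ->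
  [/\ X1 *m X1 = 0, X0 *m X1 + X1 *m X0 = X1
    & X0 *m X0 + X1 *m X1^t* + X1^t* *m X1 = X0].
Proof.
move=> PP.
suff h i j : [/\ (X1 *m X1) i j = 0, (X0 *m X1 + X1 *m X0) i j = X1 i j
    & (X0 *m X0 + X1 *m X1^t* + X1^t* *m X1) i j = X0 i j].
  by split; apply/matrixP => i j; case: (h i j) => h1 h2 h3 //; rewrite h1 mxE.
pose b := X1^t* *m X0 + X0 *m X1^t* - X1^t*.
pose c := X0 *m X0 + X1 *m X1^t* + X1^t* *m X1 - X0.
pose d := X0 *m X1 + X1 *m X0 - X1.
have [] := @trigpoly2_eq0 C ((X1^t* *m X1^t*) i j) (b i j) (c i j) (d i j)
                                                 ((X1 *m X1) i j).
  move=> z z1; have zz : z * Num.conj z = 1 by rewrite -normCK z1 expr1n.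
  have := PP z z1; set w := Num.conj z in zz * => /= /eqP.
  rewrite -subr_eq0 => /eqP/matrixP/(_ i j); rewrite [RHS]mxE => PPij.
  transitivity ((w ^+ 2 *: (X1^t* *m X1^t*) + w *: b + c + z *: d + z ^+ 2 *: (X1 *m X1)) i j).
    by rewrite !mxE.
  rewrite -[RHS]PPij; congr (fun_of_matrix _ i j).
  rewrite !(mulmxDl, mulmxDr) -!(scalemxAl, scalemxAr) !scalerA ?zz ?(mulrC w z) ?zz.
  rewrite !scale1r /b /c /d !scalerBr !scalerDr !expr2.
  apply/matrixP => k l; rewrite !mxE.
  set s1 := \sum_j _; set s2 := \sum_j _; set s3 := \sum_j _; set s4 := \sum_j _.
  set s5 := \sum_j _; set s6 := \sum_j _; set s7 := \sum_j _.
  by ring.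
by rewrite !mxE => _ /eqP; rewrite subr_eq0 => /eqP cij /eqP; rewrite subr_eq0
  => /eqP dij e.
Qed.

(** * The left support of a square-zero matrix *)

Section SupportProjection.
Variables (R : realType) (X : 'M[R[i]]_2).
Hypothesis X20 : X *m X = 0.
Let l := left_support X.

Lemma frob2_neq0 : X != 0 -> frob2 X != 0.
Proof. by rewrite frob2_eq0. Qed.

Lemma sq0_left_support : X != 0 -> l = (frob2 X)^-1 *: (X *m X^t*).
Proof. by move=> /frob2_neq0 X0; apply: left_supportE => //; exact: sq0_mul3_adj. Qed.

Lemma mul_adj_left_support : X *m X^t* = frob2 X *: l.
Proof.
have [X0|X0] := eqVneq X 0; last first.
  by rewrite sq0_left_support // scalerA mulfV ?frob2_neq0 // scale1r.
by rewrite /l X0 mul0mx left_support0 scaler0.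
Qed.

Lemma frob2_conj (C : numClosedFieldType) (A : 'M[C]_2) : Num.conj (frob2 A) = frob2 A.
Proof. by apply: CrealP; apply: ger0_real; exact: frob2_ge0. Qed.

Lemma left_support_adj : l^t* = l.
Proof.
have [X0|X0] := eqVneq X 0; first by rewrite /l X0 left_support0 trmx0 map_mx0.
rewrite sq0_left_support // linearZ /= map_mxZ fmorphV /= frob2_conj.
by rewrite trmx_mul map_mxM /= trmxCK.
Qed.

Lemma left_support_mul : l *m X = X.
Proof.
have [->|X0] := eqVneq X 0; first by rewrite mulmx0.
by rewrite sq0_left_support // -scalemxAl sq0_mul3 // scalerA mulVf ?scale1r ?frob2_neq0.
Qed.

Lemma left_support_idem : l *m l = l.
Proof.
have [X0|X0] := eqVneq X 0; first by rewrite /l X0 left_support0 mulmx0.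
rewrite {2}sq0_left_support // -scalemxAr mulmxA left_support_mul.
by rewrite -sq0_left_support.
Qed.

Lemma mul_left_support : X *m l = 0.
Proof.
have [X0|X0] := eqVneq X 0; first by rewrite /l X0 mul0mx.
by rewrite sq0_left_support // -scalemxAr mulmxA X20 mul0mx scaler0.
Qed.

Lemma left_support_trace : X != 0 -> \tr l = 1.
Proof.
by move=> X0; rewrite sq0_left_support // mxtraceZ -/(frob2 X) mulVf ?frob2_neq0.
Qed.

Lemma left_support_det : \det l = 0.
Proof.
have [X0|X0] := eqVneq X 0; first by rewrite /l X0 left_support0 det0.
by rewrite sq0_left_support // detZ det_mulmx sq0_det // mul0r mulr0.
Qed.
End SupportProjection.

(** * The eigenvalue of X0 on the range of X1 *)

Section RieffelEigenvalue.
Variables (R : realType) (X0 X1 : 'M[R[i]]_2).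
Hypotheses (X0_sa : X0 = X0^t*) (X120 : X1 *m X1 = 0)
  (X01 : X0 *m X1 + X1 *m X0 = X1)
  (X00 : X0 *m X0 + X1 *m X1^t* + X1^t* *m X1 = X0).
Let l := left_support X1.

(** The trace reads off the eigenvalue because l has rank one, and it yields the
    value 0 where X1, hence l, vanishes.  Its imaginary part is 0 by
    [support_eigenvalueE]. *)
Definition support_eigenvalue : R := complex.Re (\tr (X0 *m l)).
Local Notation g := support_eigenvalue.

Lemma support_eigenvalueE : g%:C = \tr (X0 *m l).
Proof.
apply: RRe_real; apply/CrealP; rewrite -[LHS]/(Num.conj _).
transitivity (\tr ((X0 *m l)^t*)); first by rewrite trace_map_mx mxtrace_tr.
by rewrite trmx_mul map_mxM /= -X0_sa left_support_adj // mxtrace_mulC.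
Qed.

(** X0 X1 = X1 (1 - X0) shows that X0 preserves the range of X1, i.e.
    X0 l = l X0 l, and l X0 l is the multiple tr (X0 l) of l. *)
Lemma mul_eigen_left_support : X0 *m l = g%:C *: l.
Proof.
rewrite support_eigenvalueE.
rewrite -(det0_sandwich _ (left_support_det X120)) -/l.
have [X10|X10] := eqVneq X1 0; first by rewrite /l X10 left_support0 !mulmx0.
have e : X0 *m l = (frob2 X1)^-1 *: (X1 *m (1%:M - X0) *m X1^t*).
  have <- : X0 *m X1 = X1 *m (1%:M - X0).
    by rewrite mulmxBr mulmx1 -[X in _ = X - _]X01 addrK.
  by rewrite /l sq0_left_support // -scalemxAr mulmxA.
by rewrite -mulmxA e -scalemxAr !mulmxA /l left_support_mul.
Qed.

(** The degree-0 relation applied to the range of X1, which X1 annihilates. *)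
Lemma eigenvalue_frob2 : X1 != 0 -> (g - g ^+ 2)%:C = frob2 X1.
Proof.
move=> X10; have /(congr1 (fun M => M *m l)) := X00.
rewrite !mulmxDl -!mulmxA (mul_left_support X120) mulmx0 addr0.
rewrite mul_eigen_left_support -scalemxAr mul_eigen_left_support mulmxA.
rewrite (mul_adj_left_support X120) -!scalemxAl (left_support_idem X120) -/l scalerA.
move/(congr1 mxtrace); rewrite mxtraceD !mxtraceZ (left_support_trace X120 X10) !mulr1.
by rewrite rmorphB rmorphXn /= expr2 => e; rewrite -[X in X - _]e addrC addKr.
Qed.

Lemma support_eigenvalue_le : 0 <= g <= 1.
Proof.
have [X10|X10] := eqVneq X1 0.
  by rewrite /support_eigenvalue /l X10 left_support0 mulmx0 mxtrace0 lexx ler01.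
have := frob2_ge0 X1; rewrite -eigenvalue_frob2 // ler0c => h.
by apply/andP; split; nra.
Qed.

Lemma support_eigenvalue0 : X1 = 0 -> g = 0.
Proof. by move=> X10; rewrite /support_eigenvalue /l X10 left_support0 mulmx0 mxtrace0. Qed.

End RieffelEigenvalue.

(** * Limits of complex functions *)

Section ComplexTopology.
Variable R : realType.

Lemma pos_complex (e : R[i]) : 0 < e -> exists2 d : R, 0 < d & e = d%:C.
Proof.
case: e => a b; rewrite ltcE /= => /andP[/eqP -> a0]; exists a => //.
Qed.

Lemma normc_le_ReIm (z : R[i]) : `|z| <= (`|complex.Re z| + `|complex.Im z|)%:C.
Proof.
case: z => a b /=; rewrite normc_def /= lecR -(@ler_pXn2r _ 2) ?nnegrE ?sqrtr_ge0 ?addr_ge0 //.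
rewrite sqr_sqrtr ?addr_ge0 ?sqr_ge0 // sqrrD !real_normK ?num_real //.
by rewrite -addrA lerD2l -[leLHS]add0r lerD2r mulrn_wge0 ?mulr_ge0.
Qed.

Lemma cvg_complex (T : Type) (F : set_system T) {FF : Filter F} (f : T -> R[i]^o) (z : R[i]^o) :
  (fun t => complex.Re (f t)) @ F --> complex.Re z ->
  (fun t => complex.Im (f t)) @ F --> complex.Im z -> f @ F --> z.
Proof.
move=> /cvgrPdist_lt hr /cvgrPdist_lt hi; apply/cvgrPdist_lt => e /pos_complex[d d0 ->].
have d2 : 0 < d / 2 by rewrite divr_gt0.
near=> t.
apply: le_lt_trans (normc_le_ReIm _) _.
rewrite ltcR (splitr d) ltrD //.
  rewrite (_ : complex.Re _ = complex.Re z - complex.Re (f t)).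
    by near: t; exact: hr.
  by case: (z) => ? ?; case: (f t).
rewrite (_ : complex.Im _ = complex.Im z - complex.Im (f t)).
  by near: t; exact: hi.
by case: (z) => ? ?; case: (f t).
Unshelve. all: by end_near. Qed.

Lemma cvg_Re (T : Type) (F : set_system T) {FF : Filter F} (f : T -> R[i]^o) (z : R[i]^o) :
  f @ F --> z -> (fun t => complex.Re (f t)) @ F --> complex.Re z.
Proof.
move=> /cvgrPdist_lt h; apply/cvgrPdist_lt => e e0.
have e0' : 0 < e%:C by rewrite ltcR.
near=> t; rewrite -ltcR.
have := normc_ge_Re (z - f t); rewrite [complex.Re _](_ : _ = complex.Re z - complex.Re (f t)).
  by move=> /le_lt_trans; apply; near: t; exact: h.
by case: (z) => ? ?; case: (f t).
Unshelve. all: by end_near. Qed.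

Lemma cvg_conj (T : Type) (F : set_system T) {FF : Filter F} (f : T -> R[i]^o) (z : R[i]^o) :
  f @ F --> z -> (fun t => Num.conj (f t) : R[i]^o) @ F --> (Num.conj z : R[i]^o).
Proof.
move=> /cvgrPdist_lt h; apply/cvgrPdist_lt => e e0.
near=> t; rewrite -rmorphB normcJ; near: t; exact: h.
Unshelve. all: by end_near. Qed.

Lemma continuous_real_complex : continuous (fun x : R => x%:C : R[i]^o).
Proof. by move=> x; apply: cvg_complex => /=; [exact: cvg_id|exact: cvg_cst]. Qed.

Lemma cvg_expi2pi (T : Type) (F : set_system T) {FF : Filter F} (f : T -> R) (a : R) :
  f @ F --> a -> (fun t => expi2pi (f t) : R[i]^o) @ F --> (expi2pi a : R[i]^o).
Proof.
move=> fa; have fa2 : (fun t => 2 * pi * f t) @ F --> 2 * pi * a.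
  by apply: cvgM => //; exact: cvg_cst.
apply: cvg_complex => /=.
- exact: (@continuous_cvg _ _ _ _ FF _ (@cos R) _ (@continuous_cos R _) fa2).
- exact: (@continuous_cvg _ _ _ _ FF _ (@sin R) _ (@continuous_sin R _) fa2).
Qed.

Lemma norm_expi2pi (t : R) : `|expi2pi t| = 1.
Proof. by rewrite normc_def /= cos2Dsin2 sqrtr1. Qed.

Lemma expi2pi0 : expi2pi (0 : R) = 1.
Proof. by rewrite /expi2pi mulr0 cos0 sin0. Qed.

Lemma expi2pi1 : expi2pi (1 : R) = 1.
Proof.
by rewrite /expi2pi mulr1 mulr_natl cos2pi sin2pi.
Qed.

Lemma cvg0_mul_bounded (T : Type) (F : set_system T) {FF : Filter F} (g k : T -> R[i]^o) (M : R) :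
  (forall t, `|k t| <= M%:C) ->
  g @ F --> (0 : R[i]^o) -> (fun t => g t * k t : R[i]^o) @ F --> (0 : R[i]^o).
Proof.
move=> kM /cvgrPdist_lt h; apply/cvgrPdist_lt => e e0.
have M0 : 0 < (`|M| + 1)%:C by rewrite ltcR ltr_wpDl.
near=> t; rewrite sub0r normrN normrM.
have kt : `|k t| <= (`|M| + 1)%:C.
  by apply: (le_trans (kM t)); rewrite lecR; apply: (le_trans (ler_norm M)); rewrite lerDl.
apply: (le_lt_trans (ler_wpM2l (normr_ge0 _) kt)).
rewrite -ltr_pdivlMr //.
have -> : `|g t| = `|0 - g t| by rewrite sub0r normrN.
by near: t; apply: h; rewrite divr_gt0.
Unshelve. all: by end_near. Qed.

(** The jumps of the bounded factor k are killed by the zeros of g. *)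
Lemma continuous_mul_vanishing (T : topologicalType) (g k : T -> R[i]^o) (M : R) :
  continuous g -> (forall t, `|k t| <= M%:C) ->
  (forall t, g t = 0 \/ k @ t --> k t) -> continuous (fun t => g t * k t : R[i]^o).
Proof.
move=> gc kM gk t; have [g0|kc] := gk t; last exact: cvgM (gc t) kc.
rewrite /continuous_at (_ : g t * k t = 0); last by rewrite g0 mul0r.
by apply: (cvg0_mul_bounded kM); rewrite -g0; exact: gc.
Qed.

(** The two roots g of g - g^2 = c are exchanged by g -> 1 - g, under which
    cos (2 pi g) is invariant; so it depends on c only, and continuously. *)
Lemma cos_2pi_sqrt (g c : R) : c = g - g ^+ 2 ->
  cos (2 * pi * g) = - cos (pi * Num.sqrt (1 - 4 * c)).
Proof.
move=> ->; rewrite (_ : 1 - _ = (1 - 2 * g) ^+ 2) ?sqrtr_sqr; last by ring.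
have -> : cos (pi * `|1 - 2 * g|) = cos (pi * (1 - 2 * g)).
  by case: (ger0P (1 - 2 * g)) => _; rewrite ?mulrN ?cosN.
rewrite mulrBr mulr1 (_ : pi * (2 * g) = 2 * pi * g); last by ring.
by rewrite cosB cospi sinpi mul0r addr0 mulN1r opprK.
Qed.

End ComplexTopology.

(** * Limits of matrices *)

Section MatrixLimits.
Variables (R : realType) (T : Type) (F : set_system T).
Context {FF : Filter F}.

Definition mx_cvg m n (A : T -> 'M[R[i]]_(m, n)) (L : 'M[R[i]]_(m, n)) :=
  forall i j, (fun t => A t i j : R[i]^o) @ F --> (L i j : R[i]^o).

Lemma mx_cvg_cst m n (L : 'M[R[i]]_(m, n)) : mx_cvg (fun=> L) L.
Proof. by move=> i j; exact: cvg_cst. Qed.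

Lemma cvg_sum_complex (I : Type) (r : seq I) (f : I -> T -> R[i]^o) (a : I -> R[i]^o) :
  (forall i, f i @ F --> a i) -> (fun t => \sum_(i <- r) f i t) @ F --> \sum_(i <- r) a i.
Proof.
move=> fa; elim: r => [|i r IH].
  rewrite big_nil (_ : (fun _ => _) = fun=> 0); first exact: cvg_cst.
  by apply/funext => t; rewrite big_nil.
rewrite big_cons (_ : (fun _ => _) = fun t => f i t + \sum_(i <- r) f i t).
  exact: cvgD (fa i) IH.
by apply/funext => t; rewrite big_cons.
Qed.

Lemma mx_cvgD m n (A B : T -> 'M[R[i]]_(m, n)) L M :
  mx_cvg A L -> mx_cvg B M -> mx_cvg (fun t => A t + B t) (L + M).
Proof.
move=> hA hB i j; rewrite mxE (_ : (fun _ => _) = fun t => A t i j + B t i j).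
  exact: cvgD (hA i j) (hB i j).
by apply/funext => t; rewrite mxE.
Qed.

Lemma mx_cvgZ m n (k : T -> R[i]^o) (a : R[i]^o) (A : T -> 'M[R[i]]_(m, n)) L :
  k @ F --> a -> mx_cvg A L -> mx_cvg (fun t => k t *: A t) (a *: L).
Proof.
move=> hk hA i j; rewrite mxE (_ : (fun _ => _) = fun t => k t * A t i j).
  exact: cvgM hk (hA i j).
by apply/funext => t; rewrite mxE.
Qed.

Lemma mx_cvgM m n p (A : T -> 'M[R[i]]_(m, n)) (B : T -> 'M[R[i]]_(n, p)) L M :
  mx_cvg A L -> mx_cvg B M -> mx_cvg (fun t => A t *m B t) (L *m M).
Proof.
move=> hA hB i j; rewrite mxE.
rewrite (_ : (fun _ => _) = fun t => \sum_k A t i k * B t k j).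
  by apply: cvg_sum_complex => k; exact: cvgM (hA i k) (hB k j).
by apply/funext => t; rewrite mxE.
Qed.

Lemma mx_cvg_adj m n (A : T -> 'M[R[i]]_(m, n)) L :
  mx_cvg A L -> mx_cvg (fun t => (A t)^t*) (L^t*).
Proof.
move=> hA i j; rewrite !mxE (_ : (fun _ => _) = fun t => Num.conj (A t j i)).
  exact: cvg_conj.
by apply/funext => t; rewrite !mxE.
Qed.

Lemma mx_cvg_trace n (A : T -> 'M[R[i]]_n) L :
  mx_cvg A L -> (fun t => \tr (A t) : R[i]^o) @ F --> (\tr L : R[i]^o).
Proof. by move=> hA; apply: cvg_sum_complex => i; exact: hA. Qed.

End MatrixLimits.

(** E i i is the sum of the `|E i k| ^+ 2, so E i i ^+ 2 <= E i i. *)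
Lemma projection_entry_le1 (C : numClosedFieldType) n (E : 'M[C]_n) i j :
  E^t* = E -> E *m E = E -> `|E i j| <= 1.
Proof.
move=> Ea Ei.
have d k : E k k = \sum_l `|E k l| ^+ 2.
  rewrite -[in LHS]Ei -{2}Ea mxE; apply: eq_bigr => l _; by rewrite !mxE normCK.
have le k l : `|E k l| ^+ 2 <= E k k.
  by rewrite d (bigD1 l) //= lerDl sumr_ge0 // => m _; rewrite exprn_ge0.
have E0 : 0 <= E i i by apply: le_trans (le i i); rewrite exprn_ge0.
have E1 : E i i <= 1.
  have := le i i; rewrite ger0_norm // expr2.
  move: E0; rewrite le0r => /orP[/eqP -> _|E0]; first exact: ler01.
  by rewrite -ler_pdivlMr // divff ?gt_eqF.
by rewrite -(@expr_le1 _ 2) //; exact: le_trans (le i j) E1.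
Qed.

(** * Continuity of the eigenvalue *)

Section RieffelContinuity.
Variables (R : realType) (Y : topologicalType) (X0 X1 : Y -> 'M[R[i]]_2).
Hypotheses (X0c : mx_continuous X0) (X1c : mx_continuous X1)
  (X0_sa : forall y, X0 y = (X0 y)^t*) (X120 : forall y, X1 y *m X1 y = 0)
  (X01 : forall y, X0 y *m X1 y + X1 y *m X0 y = X1 y)
  (X00 : forall y, X0 y *m X0 y + X1 y *m (X1 y)^t* + (X1 y)^t* *m X1 y = X0 y).
Let f y := support_eigenvalue (X0 y) (X1 y).
Let l y := left_support (X1 y).

Lemma frob2_continuous : continuous (fun y => frob2 (X1 y) : R[i]^o).
Proof.
move=> y; apply: mx_cvg_trace; apply: mx_cvgM; first by move=> i j; exact: X1c.
by apply: mx_cvg_adj => i j; exact: X1c.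
Qed.

Lemma open_mx_supp : open (mx_supp X1).
Proof.
rewrite openE => y /= y0.
have : \forall z \near y, `|frob2 (X1 y) - frob2 (X1 z)| < frob2 (X1 y).
  have /cvgrPdist_lt := @frob2_continuous y; apply.
  by rewrite lt_def frob2_ge0 frob2_eq0 y0.
apply: filterS => z /= hz; apply/eqP => z0; move: hz.
by rewrite z0 [frob2 0](_ : _ = 0) ?subr0 ?ger0_norm ?frob2_ge0 ?ltxx //; apply/eqP; rewrite frob2_eq0.
Qed.

Lemma left_support_cvg y : mx_supp X1 y -> mx_cvg (nbhs y) l (l y).
Proof.
move=> y0; have hl z : mx_supp X1 z -> l z = (frob2 (X1 z))^-1 *: (X1 z *m (X1 z)^t*).
  by move=> z0; apply: sq0_left_support.
have : mx_cvg (nbhs y) (fun z => (frob2 (X1 z))^-1 *: (X1 z *m (X1 z)^t*)) (l y).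
  rewrite hl //; apply: mx_cvgZ.
    by apply: cvgV; [rewrite frob2_eq0|exact: frob2_continuous].
  apply: mx_cvgM; first by move=> i j; exact: X1c.
  by apply: mx_cvg_adj => i j; exact: X1c.
move=> h i j; apply: cvg_trans (h i j); apply: near_eq_cvg.
have : \forall z \near y, mx_supp X1 z by apply: open_nbhs_nbhs; split => //; exact: open_mx_supp.
by apply: filterS => z z0; rewrite -hl.
Qed.

Lemma eigenvalue_continuous_at y : mx_supp X1 y -> f @ y --> f y.
Proof.
move=> y0; apply: cvg_Re; apply: mx_cvg_trace; apply: mx_cvgM.
  by move=> i j; exact: X0c.
exact: left_support_cvg.
Qed.

Lemma cos_eigenvalue_continuous : continuous (fun y => cos (2 * pi * f y)).
Proof.
pose c y := complex.Re (frob2 (X1 y)).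
have cf y : cos (2 * pi * f y) = - cos (pi * Num.sqrt (1 - 4 * c y)).
  have [X10|X10] := eqVneq (X1 y) 0.
    rewrite /f support_eigenvalue0 // /c X10 [frob2 0](_ : _ = 0); last by apply/eqP; rewrite frob2_eq0.
    by rewrite !mulr0 subr0 sqrtr1 mulr1 cospi opprK cos0.
  apply: cos_2pi_sqrt; apply: complexI; rewrite eigenvalue_frob2 // RRe_real //.
  by rewrite ger0_real // frob2_ge0.
have cc : continuous c by move=> y; apply: cvg_Re; exact: frob2_continuous.
rewrite (_ : (fun y => _) = fun y => - cos (pi * Num.sqrt (1 - 4 * c y))); last exact/funext.
move=> y; apply: cvgN.
apply: (@continuous_cvg _ _ _ _ _ _ (@cos R) _ (@continuous_cos R _)).
apply: cvgM; first exact: cvg_cst.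
apply: (@continuous_cvg _ _ _ _ _ _ (@Num.sqrt R) _ (@sqrt_continuous R _)).
apply: cvgB; first exact: cvg_cst.
by apply: cvgM; [exact: cvg_cst|exact: cc].
Qed.

(** Where X1 vanishes f may jump between values near 0 and values near 1, so the
    continuity of exp (2 pi i f) comes from that of its real part: there
    cos (2 pi f) = 1, and sin^2 = 1 - cos^2 forces the sine to tend to 0. *)
Lemma expi2pi_eigenvalue_continuous : continuous (fun y => expi2pi (f y) : R[i]^o).
Proof.
move=> y; have [X10|X10] := eqVneq (X1 y) 0; last first.
  by apply: cvg_expi2pi; exact: eigenvalue_continuous_at.
apply: cvg_complex => /=; first exact: cos_eigenvalue_continuous.
rewrite /f support_eigenvalue0 // mulr0 sin0.
apply/cvgrPdist_lt => e e0.
pose c z := cos (2 * pi * f z).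
have : (fun z => 1 - c z * c z) @ y --> 1 - c y * c y.
  apply: cvgB; first exact: cvg_cst.
  by apply: cvgM; exact: cos_eigenvalue_continuous.
have -> : c y = 1 by rewrite /c /f support_eigenvalue0 // mulr0 cos0.
rewrite mulr1 subrr => /cvgrPdist_lt.
move=> /(_ (e ^+ 2) (exprn_gt0 _ e0)); apply: filterS => z.
rewrite !sub0r !normrN -expr2 -sin2cos2 normrX ltr_pXn2r ?nnegrE //; exact: ltW.
Qed.

End RieffelContinuity.

(** * The power series of exp (2 pi i x) *)

Section ExponentialSeries.
Variable R : realType.

Lemma expr_i m : ('i%C : R[i]) ^+ m =
  ((~~ odd m)%:R * (-1) ^+ m./2) +i* ((odd m)%:R * (-1) ^+ m.-1./2).
Proof.
have e : ('i%C : R[i]) ^+ m = (-1) ^+ m./2 * 'i%C ^+ odd m.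
  by rewrite -{1}(odd_double_half m) addnC exprD -mul2n exprM sqr_i.
have r k : ((-1) ^+ k : R[i]) = ((-1) ^+ k)%:C by rewrite rmorphXn rmorphN rmorph1.
rewrite e r; case: (boolP (odd m)) => om /=.
  rewrite expr1; have -> : m.-1./2 = m./2.
    by case: (m) om => //= n /negPf; rewrite uphalf_half => ->.
  by rewrite -[LHS]/(_ +i* _); congr (_ +i* _) => /=; ring.
by rewrite expr0 mulr1 mul1r mul0r.
Qed.

Definition exp2pii_coeff m : R[i] := ((2 * pi)%:C * 'i%C) ^+ m / (m`!)%:R.

Lemma exp2pii_term m (x : R) :
  exp2pii_coeff m * x%:C ^+ m = cos_coeff (2 * pi * x) m +i* sin_coeff (2 * pi * x) m.
Proof.
rewrite /exp2pii_coeff mulrAC -exprMn mulrAC -rmorphM /= exprMn expr_i -rmorphXn /=.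
have -> : ((m`!)%:R : R[i])^-1 = ((m`!)%:R^-1)%:C by rewrite fmorphV rmorph_nat.
rewrite /cos_coeff /sin_coeff /=.
apply/eqP; rewrite eq_complex /= !(mul0r, mulr0, subr0, addr0, add0r).
by rewrite -exprnP !(mulrC ((2 * pi * x) ^+ m)) !eqxx.
Qed.

Lemma cvg_exp2pii (x : R) :
  (fun N => \sum_(m < N) exp2pii_coeff m * x%:C ^+ m : R[i]^o) @ \oo --> (expi2pi x : R[i]^o).
Proof.
have e N : \sum_(m < N) exp2pii_coeff m * x%:C ^+ m =
    series (cos_coeff (2 * pi * x)) N +i* series (sin_coeff (2 * pi * x)) N.
  rewrite /series /= !big_mkord; elim: N => [|N IH]; first by rewrite !big_ord0.
  by rewrite !big_ord_recr /= IH exp2pii_term.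
apply: cvg_complex => /=.
- rewrite (_ : (fun N => _) = series (cos_coeff (2 * pi * x))).
    rewrite unlock; exact: is_cvg_series_cos_coeff.
  by apply/funext => N; rewrite e.
- rewrite (_ : (fun N => _) = series (sin_coeff (2 * pi * x))).
    rewrite unlock; exact: is_cvg_series_sin_coeff.
  by apply/funext => N; rewrite e.
Qed.
End ExponentialSeries.

(** * Operators concentrated in the corner block *)

Section BlockOperators.
Variable R : realType.

(** Every product needed below has finite sums as entries, the left factor having
    finitely many nonzero blocks in each row, or the right one in each column. *)
Lemma op_mulE n (a b : op R n) K i j :
  (forall k, (K <= k)%N -> a i k *m b k j = 0) ->
  op_mul a b i j = \sum_(k < K) a i k *m b k j.
Proof.
move=> h; apply/matrixP => s t; rewrite mxE.
apply: (@cvg_lim R[i]^o (@norm_hausdorff _ _)).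
apply: cvg_near_cst; near=> N.
have KN : (K <= N)%N by near: N; exact: nbhs_infty_ge.
rewrite -(subnKC KN) big_split_ord /= [X in _ + X]big1 ?addr0 // => k _.
by rewrite h ?leq_addr.
Unshelve. all: by end_near. Qed.

Definition corner_block n (A : 'M[R[i]]_n) : op R n :=
  fun i j => if (i == 0)%N && (j == 0)%N then A else 0.

Lemma corner_sub1 n (A B : 'M[R[i]]_n) :
  op_sub (corner A) (corner B) = corner_block (A - B).
Proof.
apply/funext => i; apply/funext => j; rewrite /op_sub /corner /corner_block.
by case: ifP; rewrite ?subrr.
Qed.

Lemma corner1 n : corner 1%:M = op1 R n.
Proof.
apply/funext => i; apply/funext => j; rewrite /corner /op1.
by case: ifP => // /andP[/eqP -> /eqP ->].
Qed.

Lemma corner_off n (A : 'M[R[i]]_n) i j : i != j -> corner A i j = 0.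
Proof.
by rewrite /corner /op1 => /negPf ij; rewrite ij; case: i j ij => [|i] [|j].
Qed.

Lemma corner_mul n (A B : 'M[R[i]]_n) : op_mul (corner A) (corner B) = corner (A *m B).
Proof.
apply/funext => i; apply/funext => j.
rewrite (@op_mulE _ _ _ i.+1); last first.
  by move=> k ik; rewrite corner_off ?mul0mx // neq_ltn ik.
rewrite big_ord_recr big1 /= ?add0r => [|k _]; last first.
  by rewrite corner_off ?mul0mx // neq_ltn ltn_ord orbT.
rewrite /corner /op1 eqxx; case: i => [|i] /=; last by rewrite mul1mx.
by case: j => //= j; rewrite mulmx0.
Qed.

Lemma corner_adj n (A : 'M[R[i]]_n) : op_adj (corner A) = corner (A^t*).
Proof.
apply/funext => i; apply/funext => j; rewrite /op_adj.
have [->|ij] := eqVneq i j; last by rewrite !corner_off // 1?eq_sym // trmx0 map_mx0.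
by rewrite /corner /op1 eqxx; case: ifP => // _; rewrite trmx1 map_mx1.
Qed.

Lemma sqnorm_ge0 n (v : 'cV[R[i]]_n) : 0 <= sqnorm v.
Proof. by apply: sumr_ge0 => k _; rewrite exprn_ge0. Qed.

Lemma sqnorm0 n : sqnorm (0 : 'cV[R[i]]_n) = 0.
Proof. by apply: big1 => k _; rewrite mxE normr0 expr0n. Qed.

Lemma op_norm_le0 n (e : R) : op_norm_le (fun _ _ => 0 : 'M[R[i]]_n) e.
Proof.
move=> N v; rewrite big1 => [|i _]; last by rewrite big1 ?sqnorm0 // => j _; rewrite mul0mx.
rewrite mulr_ge0 ?ler0c ?sqr_ge0 //; apply: sumr_ge0 => j _; exact: sqnorm_ge0.
Qed.

Lemma op_norm_le_corner_block n (A : 'M[R[i]]_n) (c : R) :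
  (forall v, sqnorm (A *m v) <= (c ^+ 2)%:C * sqnorm v) -> op_norm_le (corner_block A) c.
Proof.
move=> h [|N] v; first by rewrite !big_ord0 mulr0.
rewrite !big_ord_recl /= [X in _ + X <= _]big1 => [|i _].
  rewrite addr0 big1 => [|j _]; last by rewrite mul0mx.
  rewrite addr0 mulrDr; apply: le_trans (h _) _; rewrite lerDl mulr_ge0 ?ler0c ?sqr_ge0 //.
  by apply: sumr_ge0 => j _; exact: sqnorm_ge0.
by rewrite big1 ?sqnorm0 // => j _; rewrite mul0mx.
Qed.

(** A crude bound: each coordinate of v is at most the norm of v. *)
Lemma sqnorm_mul_le n (A : 'M[R[i]]_n) (d : R) (v : 'cV[R[i]]_n) :
  (forall i j, `|A i j| <= d%:C) ->
  sqnorm (A *m v) <= n%:R ^+ 3 * d%:C ^+ 2 * sqnorm v.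
Proof.
move=> Ad; set S := sqnorm v.
have vS j : `|v j 0| <= sqrtC S.
  rewrite -(@ler_pXn2r _ 2) ?nnegrE ?sqrtC_ge0 ?sqnorm_ge0 // sqrtCK.
  by rewrite /S /sqnorm (bigD1 j) //= lerDl sumr_ge0 // => k _; rewrite exprn_ge0.
have hi i : `|(A *m v) i 0| ^+ 2 <= n%:R ^+ 2 * d%:C ^+ 2 * S.
  have d0 (j : 'I_n) : 0 <= d%:C by exact: le_trans (normr_ge0 _) (Ad i j).
  rewrite -[S]sqrtCK -!exprMn ler_pXn2r ?nnegrE ?normr_ge0 //; last first.
    by rewrite mulr_ge0 ?sqrtC_ge0 ?sqnorm_ge0 // mulr_ge0 ?ler0n ?(d0 i).
  rewrite mxE; apply: (le_trans (ler_norm_sum _ _ _)).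
  rewrite -mulrA mulr_natl -[X in _ *+ X]card_ord -sumr_const; apply: ler_sum => j _.
  by rewrite normrM ler_pM.
apply: (@le_trans _ _ (\sum_(i < n) (n%:R ^+ 2 * d%:C ^+ 2 * S))).
  by apply: ler_sum => i _; exact: hi.
by rewrite sumr_const card_ord -[leLHS]mulr_natl (exprS _ 2) !mulrA.
Qed.

Lemma corner_block_compact (X : topologicalType) n (A : X -> 'M[R[i]]_n) :
  mx_continuous A -> compact_field (fun x => corner_block (A x)).
Proof.
move=> Ac; split=> [x e e0|x e e0]; last first.
  exists 1%N; rewrite (_ : op_sub _ _ = fun _ _ => 0); first exact: op_norm_le0.
  apply/funext => i; apply/funext => j; rewrite /op_sub /op_cut /corner_block.
  by case: i j => [|i] [|j] //=; rewrite subrr.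
(* (n + 1)^2 is a denominator that is never 0 and satisfies n^3 <= (n + 1)^4. *)
pose d := e / n.+1%:R ^+ 2.
have d0 : 0 < d by rewrite divr_gt0 // exprn_gt0.
have : \forall x' \near x, forall i j, `|A x i j - A x' i j| < d%:C.
  apply: filter_forall => i; apply: filter_forall => j.
  by have /cvgrPdist_lt := Ac i j x; apply; rewrite ltcR.
apply: filterS => x' hx'.
have -> : op_sub (corner_block (A x')) (corner_block (A x)) = corner_block (A x' - A x).
  apply/funext => i; apply/funext => j; rewrite /op_sub /corner_block.
  by case: ifP => _; rewrite ?subrr.
apply: op_norm_le_corner_block => v; apply: le_trans (sqnorm_mul_le v (d := d) _) _.
  by move=> i j; rewrite !mxE distrC ltW.
apply: ler_wpM2r; first exact: sqnorm_ge0.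
have -> : n%:R ^+ 3 * d%:C ^+ 2 = (n%:R ^+ 3 * d ^+ 2)%:C :> R[i].
  by rewrite -(rmorph_nat (real_complex R)) -!rmorphXn -rmorphM.
rewrite lecR /d expr_div_n mulrA ler_pdivrMr ?exprn_gt0 // mulrC.
apply: ler_wpM2l; first exact: sqr_ge0.
rewrite -exprM -!natrX ler_nat; apply: (@leq_trans (n.+1 ^ 3)).
  by rewrite leq_exp2r.
by rewrite leq_pexp2l.
Qed.
End BlockOperators.

(** * Homotopies of unitaries in the corner *)

Section CornerUnitaries.
Variable R : realType.

Lemma corner_unitary (X : topologicalType) n (u : X -> 'M[R[i]]_n) :
  is_unitary_over u -> is_compact_unitary (fun x => corner (u x)).
Proof.
move=> [uc uu]; split=> [|x].
  rewrite (_ : (fun x => _) = fun x => corner_block (u x - 1%:M)).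
    apply: corner_block_compact => i j x; apply: mx_cvgD; last exact: mx_cvg_cst.
    by move=> k l; exact: uc.
  by apply/funext => x; rewrite -corner1 corner_sub1.
rewrite corner_adj !corner_mul -corner1; have /unitarymxP uux := uu x.
by rewrite uux (mulmx1C uux).
Qed.

Lemma op_dsum_corner m n (A : 'M[R[i]]_m) i j :
  op_dsum (corner A) (op1 R n) i j = corner (dsum A 1%:M) i j.
Proof.
rewrite /op_dsum; have [->|ij] := eqVneq i j; last first.
  by rewrite !corner_off // /op1 (negPf ij) /dsum block_mx0.
rewrite /corner /op1 eqxx; case: ifP => // _.
by rewrite /dsum -scalar_mx_block.
Qed.

Lemma castsq_corner m n (e : m = n) (A : 'M[R[i]]_m) i j :
  castsq e (corner A i j) = corner (castsq e A) i j.
Proof. by case: n / e; rewrite /castsq !castmx_id. Qed.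

Lemma op_dsum0 n (a : op R 0) (b : op R n) : op_dsum a b = b.
Proof.
apply/funext => i; apply/funext => j; rewrite /op_dsum /dsum /block_mx.
by rewrite col_flat_mx row_thin_mx.
Qed.

(** The corner embedding sends a homotopy to a homotopy.  The summand b acts on
    the zero space; it is the exponential of the lift of the projection 0. *)
Lemma K1_corner (X : topologicalType) (u v : unitary_over R X) (b : X -> op R 0) :
  K1_eq u v ->
  K1_compact_eq (fun x => corner (u x)) (fun x => op_dsum (b x) (corner (v x))).
Proof.
move=> [k [l [e [h [hu h01]]]]]; exists k, l, e, (fun xt => corner (h xt)).
split; first exact: corner_unitary.
move=> x t i j; have [h0 h1] := h01 x t; split=> [/h0 ->|/h1 ->].
  by rewrite op_dsum_corner castsq_corner.
by rewrite op_dsum0 op_dsum_corner.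
Qed.

Lemma dsum_unitary (X : topologicalType) n l (u : X -> 'M[R[i]]_n) :
  is_unitary_over u -> is_unitary_over (fun x => dsum (u x) (1%:M : 'M[R[i]]_l)).
Proof.
move=> [uc uu]; split=> [i j x|x].
  rewrite /dsum; case: (split_ordP i) => i' ->; case: (split_ordP j) => j' ->.
  - under eq_fun do rewrite block_mxEul; exact: uc.
  - under eq_fun do rewrite block_mxEur; exact: cvg_cst.
  - under eq_fun do rewrite block_mxEdl; exact: cvg_cst.
  - under eq_fun do rewrite block_mxEdr; exact: cvg_cst.
have /unitarymxP uux := uu x; apply/unitarymxP.
rewrite /dsum tr_block_mx map_block_mx mulmx_block uux !trmx0 !map_mx0 trmx1 map_mx1.
by rewrite !mulmx0 !mul0mx mul1mx addr0 !add0r -scalar_mx_block.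
Qed.

Lemma K1_eq_refl (X : topologicalType) (u : unitary_over R X) : K1_eq u u.
Proof.
exists 0%N, 0%N, erefl, (fun xt => dsum (u xt.1) 1%:M); split; last first.
  by move=> x t; rewrite /castsq castmx_id.
have [uc uu] := dsum_unitary 0 (umxP u); split=> [i j xt|xt]; last exact: uu.
apply: (@continuous_comp _ _ _ (fun xt : X * unit_interval R => xt.1)
  (fun x => dsum (u x) (1%:M : 'M[R[i]]_0) i j : R[i]^o)); first exact: cvg_fst.
exact: uc.
Qed.

End CornerUnitaries.

(** * The Toeplitz lift and its exponential *)

(** No approximation or compact correction is used: at every precision the
    polynomial is p itself and F = 0. *)
Lemma toeplitz_lift_trigpoly (R : realType) (Y : topologicalType) n N (c : int -> Y -> 'M[R[i]]_n)
    (p : Y * circle R -> 'M[R[i]]_n) :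
  (forall k, mx_continuous (c k)) -> (forall k y, (N < `|k|)%N -> c k y = 0) ->
  (forall y z, trigpoly N (c^~ y) (set_val z) = p (y, z)) ->
  toeplitz_lift (fun y => toeplitz (c^~ y)) p.
Proof.
move=> cc cN cp e e0; exists N, c, (fun=> corner_block 0); split=> //.
- by apply: corner_block_compact => i j; exact: cst_continuous.
- by move=> y z s t; rewrite cp subrr normr0 ler0c ltW.
move=> y; rewrite (_ : op_sub _ _ = fun _ _ => 0); first exact: op_norm_le0.
by apply/funext => i; apply/funext => j; rewrite /op_sub /corner_block subrr if_same subr0.
Qed.

Section RieffelToeplitz.
Variables (R : realType) (n : nat).

Definition rieffel_coef (X0 X1 : 'M[R[i]]_n) (k : int) : 'M[R[i]]_n :=
  match k with
  | Posz 0 => X0 | Posz 1 => X1 | Negz 0 => X1^t* | _ => 0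
  end.

Lemma trigpoly_rieffel (X0 X1 : 'M[R[i]]_n) (z : R[i]) : `|z| = 1 ->
  trigpoly 1 (rieffel_coef X0 X1) z = conjc z *: X1^t* + X0 + z *: X1.
Proof.
move=> z1; rewrite /trigpoly !big_ord_recr big_ord0 /= add0r.
rewrite (_ : 0%:Z - 1%:Z = -1) // (_ : 1%:Z - 1%:Z = 0) // (_ : 2%:Z - 1%:Z = 1) //.
rewrite expr1z expr0z scale1r exprN1 conjcE; congr (_ *: _ + _ + _).
by rewrite invc_norm z1 expr1n invr1 mul1r.
Qed.

Variables (X0 X1 : 'M[R[i]]_n).
Let c := rieffel_coef X0 X1.
Let a : op R n := toeplitz c.

Lemma rieffel_opE (b : op R n) i j : op_mul a b i j = \sum_(k < i.+2) a i k *m b k j.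
Proof.
apply: op_mulE => k ik; rewrite /a /toeplitz -(subnKC ik) PoszD opprD addrA.
rewrite (_ : i%:Z - i.+2%:Z = -2); last by lia.
by case: (k - i.+2)%N => [|m]; rewrite ?mul0mx.
Qed.

Lemma rieffel_op_row0 (b : op R n) j : op_mul a b 0 j = X0 *m b 0 j + X1^t* *m b 1 j.
Proof. by rewrite rieffel_opE !big_ord_recr big_ord0 /= add0r. Qed.

Lemma rieffel_op_combination (b1 b2 b3 : op R n) (x1 x2 x3 : R[i]) i j :
  op_mul a (fun i j => x1 *: b1 i j + x2 *: b2 i j + x3 *: b3 i j) i j =
  x1 *: op_mul a b1 i j + x2 *: op_mul a b2 i j + x3 *: op_mul a b3 i j.
Proof.
rewrite !rieffel_opE !scaler_sumr -!big_split; apply: eq_bigr => k _ /=.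
by rewrite !mulmxDr -!scalemxAr.
Qed.

Lemma rieffel_op_mul1 : op_mul a (op1 R n) = a.
Proof.
apply/funext => i; apply/funext => j; rewrite (@op_mulE _ _ _ _ j.+1); last first.
  by move=> k jk; rewrite /op1 (gtn_eqF jk) mulmx0.
rewrite big_ord_recr big1 /= ?add0r => [|k _]; last first.
  by rewrite /op1 (ltn_eqF (ltn_ord k)) mulmx0.
by rewrite /op1 eqxx mulmx1.
Qed.

Lemma rieffel_op_rowS (b : op R n) i j :
  op_mul a b i.+1 j = X1 *m b i j + X0 *m b i.+1 j + X1^t* *m b i.+2 j.
Proof.
rewrite rieffel_opE.
rewrite !big_ord_recr big1 /= ?add0r => [|k _]; last first.
  rewrite /a /toeplitz -[i.+1](subnK (leqW (ltnW (ltn_ord k)))).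
  rewrite PoszD addrK subSn ?(ltnW (ltn_ord k)) // -(@prednK (i - k)) ?subn_gt0 ?ltn_ord //.
  by rewrite mul0mx.
rewrite /a /toeplitz.
rewrite (_ : i.+1%:Z - i%:Z = 1); last by lia.
rewrite (_ : i.+1%:Z - i.+1%:Z = 0); last by lia.
by rewrite (_ : i.+1%:Z - i.+2%:Z = -1) //; lia.
Qed.

End RieffelToeplitz.

(** From here on g is the eigenvalue f at one point, a is the operator
    S' X1' + X0 + X1 S, and [corner_block l] plays the part of E. *)
Section RieffelExponential.
Variables (R : realType) (X0 X1 : 'M[R[i]]_2).
Hypotheses (X0_sa : X0 = X0^t*) (X120 : X1 *m X1 = 0)
  (X01 : X0 *m X1 + X1 *m X0 = X1)
  (X00 : X0 *m X0 + X1 *m X1^t* + X1^t* *m X1 = X0).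
Let l := left_support X1.
Let g : R[i] := (support_eigenvalue X0 X1)%:C.
Let a : op R 2 := toeplitz (rieffel_coef X0 X1).

Lemma rieffel_op_corner_block i j : op_mul a (corner_block l) i j = g *: corner_block l i j.
Proof.
case: i => [|i].
  rewrite rieffel_op_row0 /corner_block /= mulmx0 addr0; case: ifP => _.
    exact: mul_eigen_left_support.
  by rewrite mulmx0 scaler0.
rewrite rieffel_op_rowS /corner_block /= !mulmx0 !addr0 scaler0; case: ifP => _.
  exact: mul_left_support.
by rewrite mulmx0.
Qed.

Lemma mul_adj_eigenvalue : X1 *m X1^t* = (g - g ^+ 2) *: l.
Proof.
rewrite (mul_adj_left_support X120) /l; have [->|X10] := eqVneq X1 0.
  by rewrite left_support0 !scaler0.
by rewrite -(eigenvalue_frob2 X0_sa X120 X01 X00 X10) rmorphB rmorphXn.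
Qed.

Lemma mixed_relation_adj : X0 *m X1^t* + X1^t* *m X0 = X1^t*.
Proof.
have /(congr1 (fun M => M^t*)) := X01.
by rewrite linearD /= map_mxD !trmx_mul !map_mxM /= -X0_sa addrC.
Qed.

(** Away from row 0 this is the convolution identity P^2 = P for the Fourier
    coefficients.  In row 0 the term coming from column -1 is missing: it is
    X1 X1^t* at (0, 0) and zero elsewhere. *)
Lemma rieffel_op_sq i j : op_mul a a i j = a i j - (g - g ^+ 2) *: corner_block l i j.
Proof.
have X1a0 := sq0_adj X120.
case: i => [|i].
  rewrite rieffel_op_row0 /corner_block /a /toeplitz /=.
  case: j => [|[|[|j]]] /=.
  - by rewrite -mul_adj_eigenvalue -[X in _ = X - _]X00 addrAC addrK.
  - by rewrite scaler0 subr0 mixed_relation_adj.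
  - by rewrite mulmx0 X1a0 addr0 scaler0 subr0.
  - by rewrite !mulmx0 addr0 scaler0 subr0.
rewrite rieffel_op_rowS /corner_block /= scaler0 subr0 /a /toeplitz.
have [d ed] : exists d, i.+1%:Z - j%:Z = d by eexists.
have -> : i%:Z - j%:Z = d - 1 by lia.
have -> : i.+2%:Z - j%:Z = d + 1 by lia.
rewrite ed.
case: d ed => [[|[|[|d]]]|[|[|d]]] _ /=.
- by rewrite -[RHS]X00 [X in X + _ = _]addrC.
- by rewrite mulmx0 addr0 addrC X01.
- by rewrite X120 !mulmx0 !addr0.
- by rewrite !mulmx0 !addr0.
- by rewrite mulmx0 add0r mixed_relation_adj.
- by rewrite !mulmx0 !add0r X1a0.
- by rewrite !mulmx0 !addr0.
Qed.

(** This is g^m E + 1^m (a - g E) + 0^m (1 - E - (a - g E)), the spectral form of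
    a^m, with 0 ^+ 0 = 1, expanded on E, a and 1. *)
Definition rieffel_power m : op R 2 := fun i j =>
  (g ^+ m - g - 0 ^+ m * (1 - g)) *: corner_block l i j + (1 - 0 ^+ m) *: a i j
  + 0 ^+ m *: op1 R 2 i j.

Lemma iter_rieffel_op m : iter m (op_mul a) (op1 R 2) = rieffel_power m.
Proof.
elim: m => [|m IH].
  apply/funext => i; apply/funext => j; rewrite /rieffel_power !expr0 mul1r.
  by rewrite opprB addrA subrK !subrr !scale0r !add0r scale1r.
rewrite iterS IH; apply/funext => i; apply/funext => j.
rewrite rieffel_op_combination rieffel_op_corner_block rieffel_op_sq rieffel_op_mul1.
rewrite /rieffel_power; apply/matrixP => s t; rewrite !mxE (exprS g m).
rewrite [0 ^+ m.+1]expr0n /=; set z := 0 ^+ m; set w := g ^+ m.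
by rewrite -/a; ring.
Qed.

(** The eigenvalues of a are g, 1 and 0, and the last two are sent to 1 by
    exp (2 pi i x). *)
Lemma exp_rieffel_op : op_exp2pii a =
  corner (1%:M - l + expi2pi (support_eigenvalue X0 X1) *: l).
Proof.
apply/funext => i; apply/funext => j; apply/matrixP => s t; rewrite mxE.
apply: (@cvg_lim R[i]^o (@norm_hausdorff _ _)).
pose e := corner_block l i j s t; pose q := a i j s t - g * e.
pose r := op1 R 2 i j s t - e - q.
have -> : corner (1%:M - l + expi2pi (support_eigenvalue X0 X1) *: l) i j s t =
   expi2pi (support_eigenvalue X0 X1) * e + expi2pi 1 * q + expi2pi 0 * r.
  rewrite expi2pi0 expi2pi1 !mul1r /r.
  transitivity (op1 R 2 i j s t - e + expi2pi (support_eigenvalue X0 X1) * e); last by ring.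
  rewrite /corner /e /corner_block; case: ifP => [|_]; last by rewrite !mxE; ring.
  by move=> /andP[/eqP -> /eqP ->]; rewrite /op1 eqxx !mxE.
rewrite (_ : (fun N => _) = fun N =>
   (\sum_(m < N) exp2pii_coeff R m * g ^+ m) * e
   + (\sum_(m < N) exp2pii_coeff R m * 1%:C ^+ m) * q
   + (\sum_(m < N) exp2pii_coeff R m * 0%:C ^+ m) * r).
  have cv x y : (fun N => (\sum_(m < N) exp2pii_coeff R m * x%:C ^+ m) * y : R[i]^o) @ \oo
      --> (expi2pi x * y : R[i]^o).
    by apply: cvgM; [exact: cvg_exp2pii|exact: cvg_cst].
  by apply: cvgD; first apply: cvgD; exact: cv.
apply/funext => N; rewrite !mulr_suml -!big_split; apply: eq_bigr => m _ /=.
rewrite iter_rieffel_op /rieffel_power !mxE -!mulrA -!mulrDr; congr (_ * _).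
rewrite expr1n -/e /r /q; set o := op1 _ _ _ _ _ _; set z := 0 ^+ m.
by congr (_ * _); set w := g ^+ m; rewrite -/a; set b := a i j s t; ring.
Qed.

End RieffelExponential.

(** * Unitaries that differ from 1 along a projection *)

Section PinchedUnitary.
Variable R : realType.

(** Since U is open, a neighbourhood in the subspace U is one in Y. *)
Lemma continuous_open_sub (Y Z T : topologicalType) (U : set Y)
    (F : set_type U * Z -> T) (G : Y * Z -> T) (u : set_type U) (z : Z) :
  open U -> (forall u z, G (set_val u, z) = F (u, z)) -> continuous F ->
  G @ (set_val u, z) --> G (set_val u, z).
Proof.
move=> oU GF Fc A; rewrite GF => /(Fc (u, z)) [[B C] /= [[_ [[V oV <-] /= Vu VB]] Cz] BCA].
exists (V `&` U, C) => /=.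
  split=> //; apply: open_nbhs_nbhs; split; first exact: openI.
  by split=> //; apply/set_mem; exact: (valP u).
move=> [y z'] /= [[Vy Uy] Cz'].
have := BCA (exist _ y (mem_set Uy), z'); rewrite /= -GF; apply.
by split=> //; exact: VB.
Qed.

(** The function is 1 + (lam - 1) E, so E may be discontinuous where lam = 1. *)
Lemma pinched_unitary (X : topologicalType) n (E : X -> 'M[R[i]]_n) (lam : X -> R[i]^o) :
  (forall x, (E x)^t* = E x) -> (forall x, E x *m E x = E x) ->
  continuous lam -> (forall x, `|lam x| = 1) ->
  (forall x, lam x = 1 \/ mx_cvg (nbhs x) E (E x)) ->
  is_unitary_over (fun x => 1%:M - E x + lam x *: E x).
Proof.
move=> Ea Ei lc l1 lE; split=> [i j x|x].
  rewrite (_ : (fun x => _) = fun x => (1%:M : 'M[R[i]]_n) i j + (lam x - 1) * E x i j).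
    rewrite /continuous_at; apply: cvgD; first exact: cvg_cst.
    apply: (@continuous_mul_vanishing _ _ (fun x => lam x - 1) (fun x => E x i j) 1).
    - by move=> z; apply: cvgB; [exact: lc|exact: cvg_cst].
    - by move=> z; exact: projection_entry_le1.
    - by move=> z; case: (lE z) => [->|h]; [left; rewrite subrr|right; exact: h].
  by apply/funext => z; rewrite !mxE; ring.
apply/unitarymxP; set l := lam x; set e := E x.
have ll : l * Num.conj l = 1 by rewrite -normCK l1 expr1n.
rewrite linearD linearB /= linearZ /= trmx1 !map_mxD map_mxN map_mx1 map_mxZ /= Ea -/e.
rewrite !(mulmxDl, mulmxDr, mulmxBl, mulmxBr, mulmxN, mulNmx).
rewrite -!(scalemxAl, scalemxAr) !mulmx1 !mul1mx Ei -/e.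
apply/matrixP => i j; rewrite !mxE /=.
set o := _%:R; set w := e i j.
transitivity (o + (l * Num.conj l - 1) * w); first by ring.
by rewrite ll subrr mul0r addr0.
Qed.
End PinchedUnitary.

(** * Rotating a rank-one projection to a coordinate one *)

(** Since V + V^t* and V V^t* are scalars, every point of the segment from 1 to V
    is a multiple of a unitary, and since a >= 0 it is a nonzero one.  Dividing
    by [rotN], the square of the multiple, makes conjugation by it map
    projections to projections. *)
Section Rotation.
Variables (R : realType) (V : 'M[R[i]]_2) (a N : R).
Hypotheses (a0 : 0 <= a) (N0 : 0 < N) (VD : V + V^t* = (2 * a)%:C%:M)
  (VV : V *m V^t* = N%:C%:M).

Definition rotN (t : R) : R := (1 - t) ^+ 2 + 2 * t * (1 - t) * a + t ^+ 2 * N.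
Definition rotW (t : R) : 'M[R[i]]_2 := (1 - t)%:C%:M + t%:C *: V.
Definition rot (t : R) (Q : 'M[R[i]]_2) : 'M[R[i]]_2 :=
  (rotN t)^-1%:C *: (rotW t *m Q *m (rotW t)^t*).

Lemma rotN_gt0 t : 0 <= t <= 1 -> 0 < rotN t.
Proof.
move=> /andP[t0]; rewrite le_eqVlt => /orP[/eqP ->|t1].
  by rewrite /rotN subrr expr0n /= mulr0 mul0r !add0r expr1n mul1r.
have s0 : 0 < 1 - t by rewrite subr_gt0.
rewrite /rotN -addrA ltr_wpDr ?exprn_gt0 // addr_ge0 //.
  by rewrite !mulr_ge0 // ltW.
by rewrite mulr_ge0 ?sqr_ge0 // ltW.
Qed.

Lemma rotWadj t : (rotW t)^t* = (1 - t)%:C%:M + t%:C *: V^t*.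
Proof.
rewrite /rotW linearD /= linearZ /= tr_scalar_mx map_mxD map_scalar_mx map_mxZ /=.
by rewrite -!conjcE !conjc_real.
Qed.

Lemma rotWW t : rotW t *m (rotW t)^t* = (rotN t)%:C%:M.
Proof.
rewrite rotWadj /rotW mulmxDl !mulmxDr -!(scalemxAl, scalemxAr) VV.
rewrite -scalar_mxM mul_scalar_mx mul_mx_scalar !scalerA.
rewrite addrA -[X in X + _]addrA [t%:C * _]mulrC -scalerDr [_ + V]addrC VD.
rewrite !scale_scalar_mx; apply/matrixP => i j; rewrite !mxE -!mulrnDl.
rewrite -!rmorphM -!rmorphD /=; congr (_%:C *+ _).
by rewrite /rotN; ring.
Qed.

Lemma rotWW' t : 0 <= t <= 1 -> (rotW t)^t* *m rotW t = (rotN t)%:C%:M.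
Proof.
move=> t01; have N1 : (rotN t)%:C != 0 :> R[i].
  by rewrite (fmorph_eq0 (real_complex R)) gt_eqF ?rotN_gt0.
have := rotWW t; move/(congr1 (fun M => ((rotN t)%:C)^-1 *: M)).
rewrite scalemxAr scale_scalar_mx mulVf // => /mulmx1C.
rewrite -scalemxAl => /(congr1 (fun M => (rotN t)%:C *: M)).
by rewrite scalerA mulfV // scale1r scale_scalar_mx mulr1.
Qed.

Lemma rot_adj t Q : Q^t* = Q -> (rot t Q)^t* = rot t Q.
Proof.
move=> Qa; rewrite /rot linearZ /= map_mxZ /= -conjcE conjc_real; congr (_ *: _).
by rewrite !trmx_mul !map_mxM /= trmxCK Qa mulmxA.
Qed.

Lemma rot_idem t Q : 0 <= t <= 1 -> Q *m Q = Q -> rot t Q *m rot t Q = rot t Q.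
Proof.
move=> t01 QQ; rewrite /rot -scalemxAl -scalemxAr !mulmxA.
rewrite -(mulmxA _ _ (rotW t)) rotWW' // mul_mx_scalar -!scalemxAl scalerA.
rewrite -(mulmxA _ Q Q) QQ scalerA -rmorphM /=; congr (_ *: _).
by rewrite -rmorphM /= mulVf ?mulr1 // gt_eqF ?rotN_gt0.
Qed.

Lemma rot0 Q : rot 0 Q = Q.
Proof.
rewrite /rot /rotN /rotW subr0 scale0r addr0 trmx1 map_mx1 mul1mx mulmx1.
by rewrite expr1n mulr0 !mul0r expr0n /= mul0r !addr0 invr1 scale1r.
Qed.

Lemma rot1 Q : rot 1 Q = N^-1%:C *: (V *m Q *m V^t*).
Proof.
rewrite /rot /rotN rotWadj /rotW subrr expr0n /= mulr0 mul0r !add0r expr1n mul1r.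
by rewrite (_ : 0%:C%:M = 0 :> 'M[R[i]]_2) ?raddf0 // !add0r !scale1r.
Qed.

Lemma rot_cvg (T : Type) (F : set_system T) {FF : Filter F} (s : T -> R) (t : R)
    (Q : T -> 'M[R[i]]_2) (L : 'M[R[i]]_2) :
  0 <= t <= 1 -> s @ F --> t -> mx_cvg F Q L -> mx_cvg F (fun x => rot (s x) (Q x)) (rot t L).
Proof.
move=> t01 st QL.
have sC (h : R -> R) : h (s x) @[x --> F] --> h t ->
    (fun x => (h (s x))%:C : R[i]^o) @ F --> ((h t)%:C : R[i]^o).
  move=> hst; exact: (@continuous_cvg _ _ _ _ FF _ _ _ (@continuous_real_complex R _) hst).
have s1 : (fun x => 1 - s x) @ F --> 1 - t by apply: cvgB => //; exact: cvg_cst.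
have sW : mx_cvg F (fun x => rotW (s x)) (rotW t).
  apply: mx_cvgD; last by apply: mx_cvgZ; [exact: (sC id)|exact: mx_cvg_cst].
  rewrite -scalemx1; rewrite (_ : (fun x => _) = fun x => (1 - s x)%:C *: 1%:M).
    by apply: mx_cvgZ; [exact: (sC (fun u => 1 - u))|exact: mx_cvg_cst].
  by apply/funext => x; rewrite scalemx1.
apply: mx_cvgZ; last first.
  by apply: mx_cvgM; [exact: mx_cvgM|exact: mx_cvg_adj].
apply: (sC (fun u => (rotN u)^-1)); apply: cvgV; first by rewrite gt_eqF ?rotN_gt0.
rewrite /rotN; apply: cvgD; first apply: cvgD.
- by under eq_fun do rewrite expr2; rewrite expr2; apply: cvgM.
- apply: cvgM; last exact: cvg_cst.
  by apply: cvgM => //; apply: cvgM => //; exact: cvg_cst.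
- apply: cvgM; last exact: cvg_cst.
  by under eq_fun do rewrite expr2; rewrite expr2; apply: cvgM.
Qed.
End Rotation.

(** Let p be the projection on the line of (x, y), with the phase chosen so that
    x is real and nonnegative.  Then V, with rows (x, conj y) and (- y, x), sends (x, y)
    to (x^2 + |y|^2, 0).  The first column of p is such a vector when p 0 0 is
    nonzero, and otherwise (0, 1) is. *)
Lemma rank1_projection_rotation (R : realType) (p : 'M[R[i]]_2) :
  p^t* = p -> p *m p = p -> \tr p = 1 ->
  exists (V : 'M[R[i]]_2) (a N : R), [/\ 0 <= a, 0 < N, V + V^t* = (2 * a)%:C%:M,
    V *m V^t* = N%:C%:M & V *m p *m V^t* = N%:C *: delta_mx 0 0].
Proof.
move=> pa pp tr1.
have p00 : 0 <= p 0 0.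
  by rewrite -pp -{2}pa mulmx2E !mxE -!normCK addr_ge0 ?exprn_ge0.
have p10 : p 0 1 = Num.conj (p 1 0) by rewrite -[in LHS]pa !mxE.
have p11 : p 1 1 = 1 - p 0 0 by rewrite -tr1 mxtrace2 addrC addKr.
have q00 : p 1 0 * Num.conj (p 1 0) = p 0 0 - p 0 0 * p 0 0.
  have := mulmx2E p p 0 0; rewrite pp p10 => e.
  by rewrite [X in _ = X - _]e [X in X - _]addrC addrK mulrC.
have e10 : (1 == 0 :> 'I_2) = false by [].
have e01 : (0 == 1 :> 'I_2) = false by [].
pose V (x y : R[i]) : 'M[R[i]]_2 := \matrix_(i, j)
  if i == 0 then (if j == 0 then x else Num.conj y) else (if j == 0 then - y else x).
have hV x y (a N : R) : 0 <= a -> 0 < N -> x = a%:C -> N%:C = x * x + y * Num.conj y ->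
    N%:C * p 0 0 = x * x -> N%:C * p 1 0 = y * x -> N%:C * p 1 1 = y * Num.conj y ->
    exists (V : 'M[R[i]]_2) (a N : R), [/\ 0 <= a, 0 < N, V + V^t* = (2 * a)%:C%:M,
    V *m V^t* = N%:C%:M & V *m p *m V^t* = N%:C *: delta_mx 0 0].
  move=> a0 N0 xa NE N00 N10 N11; exists (V x y), a, N.
  have cx : Num.conj x = x by rewrite xa -conjcE conjc_real.
  have N01 : N%:C * p 0 1 = x * Num.conj y.
    have := congr1 Num.conj N10; rewrite !rmorphM /= cx p10 (mulrC x) => <-.
    by rewrite (conjc_real N : Num.conj N%:C = N%:C).
  split=> //.
  - have a2 : (2 * a)%:C = x + x by rewrite xa -rmorphD mulr2n mulrDl mul1r.
    rewrite a2; apply: matrix2P; rewrite !mxE ?e10 ?e01 ?eqxx /=;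
      rewrite ?cx ?rmorphN ?conjCK ?mulr1n ?mulr0n //; ring.
  - rewrite NE; apply: matrix2P; rewrite mulmx2E !mxE ?e10 ?e01 ?eqxx /=;
      rewrite ?cx ?rmorphN ?conjCK ?mulr1n ?mulr0n /=; ring.
  apply: (scalerI (a := N%:C)).
    by rewrite (fmorph_eq0 (real_complex R)) gt_eqF.
  rewrite scalemxAl scalemxAr scalerA.
  have Np : N%:C *: p = \matrix_(i, j)
      ((if i == 0 then x else y) * (if j == 0 then x else Num.conj y)).
    by apply: matrix2P; rewrite !mxE ?e10 ?e01 ?eqxx /= ?N00 ?N10 ?N11 ?N01.
  rewrite Np NE.
  apply: matrix2P; rewrite !mulmx2E !mxE ?e10 ?e01 ?eqxx /=;
    rewrite ?cx ?rmorphN ?conjCK ?mulr1 ?mulr0 /=; ring.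
have [z|nz] := eqVneq (p 0 0) 0.
  have b0 : p 1 0 = 0.
    by apply/eqP; rewrite -normr_eq0 -sqrf_eq0 normCK q00 z mulr0 subrr.
  apply: (hV 0 1 0 1) => //; rewrite ?z ?b0 ?p11 ?z ?rmorph1 ?mulr0 ?mulr1 ?add0r ?subr0 ?mul1r //.
have pE : p 0 0 = (complex.Re (p 0 0))%:C by rewrite RRe_real // ger0_real.
apply: (hV (p 0 0) (p 1 0) (complex.Re (p 0 0)) (complex.Re (p 0 0))) => //.
- by rewrite -ler0c -pE.
- by rewrite -ltcR -pE lt_def nz.
- by rewrite -pE q00 addrC subrK.
- by rewrite -pE.
- by rewrite -pE mulrC.
- by rewrite -pE p11 q00; ring.
Qed.

(** * The boundary of a Rieffel projection *)

Lemma dsum_empty (R : realType) (A : 'M[R[i]]_2) (B : 'M[R[i]]_0) :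
  dsum A B = (A : 'M[R[i]]_(2 + 0)%N).
Proof.
apply/matrixP => i j; rewrite /dsum; case: (split_ordP i) => i' ->; last by case: i'.
case: (split_ordP j) => j' ->; last by case: j'.
by rewrite block_mxEul; congr (A _ _); exact: val_inj.
Qed.

Section RieffelField.
Variables (R : realType) (Y : topologicalType) (X0 X1 : Y -> 'M[R[i]]_2).
Hypotheses (X0c : mx_continuous X0) (X1c : mx_continuous X1)
  (X0_sa : forall y, X0 y = (X0 y)^t*) (X120 : forall y, X1 y *m X1 y = 0)
  (X01 : forall y, X0 y *m X1 y + X1 y *m X0 y = X1 y)
  (X00 : forall y, X0 y *m X0 y + X1 y *m (X1 y)^t* + (X1 y)^t* *m X1 y = X0 y).
Let f y := support_eigenvalue (X0 y) (X1 y).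
Let l y := left_support (X1 y).

Lemma expi2pi_off_supp y : X1 y = 0 -> expi2pi (f y) = 1.
Proof. by move=> X10; rewrite /f support_eigenvalue0 // expi2pi0. Qed.

Lemma rieffel_unitary :
  is_unitary_over (fun y => 1%:M - l y + expi2pi (f y) *: l y).
Proof.
apply: (@pinched_unitary _ _ _ l (fun y => expi2pi (f y))) => y.
- exact: left_support_adj.
- exact: left_support_idem.
- exact: expi2pi_eigenvalue_continuous.
- exact: norm_expi2pi.
- have [X10|X10] := eqVneq (X1 y) 0; first by left; exact: expi2pi_off_supp.
  by right; apply: left_support_cvg.
Qed.

(** [P] is [P] - [0], and the lift of the projection 0 acts on the zero space. *)
Lemma PV_boundary_rieffel (P_projection : is_projection_over (rieffel X0 X1))
    (v : unitary_over R Y) :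
  K1_eq (UnitaryOver rieffel_unitary) v ->
  PV_boundary (K0_class (ProjectionOver P_projection)) (K1_class v).
Proof.
move=> wv; pose c k y := rieffel_coef (X0 y) (X1 y) k.
exists (ProjectionOver P_projection), (ProjectionOver (is_projection_over0 R _)), v,
  (fun y => toeplitz (c^~ y)), (fun y => toeplitz (fun=> 0)); split=> //.
- split; last first.
    move=> y; apply/funext => i; apply/funext => j; rewrite /op_adj /toeplitz -opprB.
    case: (i%:Z - j%:Z) => [[|[|k]]|[|k]] //=; rewrite ?trmx0 ?map_mx0 //.
    by rewrite trmxCK.
  apply: (toeplitz_lift_trigpoly (N := 1)).
  + case=> [[|[|k]]|[|k]]; [exact: X0c|exact: X1c| | |].
    * by move=> i j; exact: cst_continuous.
    * by move=> i j y; apply: mx_cvg_adj => s t; exact: X1c.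
    * by move=> i j; exact: cst_continuous.
  + by case=> [[|[|k]]|[|k]].
  + move=> y z; rewrite trigpoly_rieffel //; exact: (set_mem (valP z)).
- split; last by move=> y; apply/funext => i; apply/funext => j; apply/matrixP => -[].
  apply: (toeplitz_lift_trigpoly (N := 0) (c := fun _ _ => 0)) => //.
  + by move=> k [].
  + by move=> y z; apply/matrixP => -[].
rewrite (_ : (fun y => op_exp2pii _) = fun y => corner (UnitaryOver rieffel_unitary y)).
  exact: (K1_corner (fun=> op_exp2pii (toeplitz (fun=> 0))) wv).
apply/funext => y; exact: exp_rieffel_op.
Qed.

(** The homotopy moves the projection l(y) along the contraction and rotates it
    to the first coordinate at the same time. *)
Lemma K1_eq_contractible_supp
    (hv : is_unitary_over (fun y => (expi2pi (f y))%:M : 'M[R[i]]_1)) :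
  contractible R (set_type (mx_supp X1)) ->
  K1_eq (UnitaryOver rieffel_unitary) (UnitaryOver hv).
Proof.
move=> [c [H [Hc H01]]].
have c0 : X1 (set_val c) != 0 by exact: (set_mem (valP c)).
have [V [a [N [a0 N0 VD VV VpV]]]] := rank1_projection_rotation
  (left_support_adj (X120 (set_val c))) (left_support_idem (X120 (set_val c)))
  (left_support_trace (X120 (set_val c)) c0).
have t01 (t : unit_interval R) : 0 <= set_val t <= 1.
  by have := set_mem (valP t); rewrite /= in_itv.
pose G (yt : Y * unit_interval R) : 'M[R[i]]_2 :=
  if pselect (mx_supp X1 yt.1) is left h
  then rot V a N (set_val yt.2) (l (set_val (H (exist _ yt.1 (mem_set h), yt.2)))) else 0.
have GE (u : set_type (mx_supp X1)) t :
    G (set_val u, t) = rot V a N (set_val t) (l (set_val (H (u, t)))).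
  rewrite /G; case: pselect => [h|]; last by case: (set_mem (valP u)).
  case: u h => u uP h /=; set uh := exist _ _ _.
  by have -> : uh = exist _ u uP by exact: val_inj.
exists 0%N, 1%N, erefl, (fun yt => 1%:M - G yt + expi2pi (f yt.1) *: G yt); split.
  apply: pinched_unitary.
  - move=> yt; rewrite /G; case: pselect => h; last by rewrite trmx0 map_mx0.
    by apply: rot_adj; exact: left_support_adj.
  - move=> yt; rewrite /G; case: pselect => h; last by rewrite mulmx0.
    by apply: rot_idem => //; exact: left_support_idem.
  - move=> yt; apply: (@continuous_comp _ _ _ (fun yt : Y * unit_interval R => yt.1)
      (fun y => expi2pi (f y) : R[i]^o)); first exact: cvg_fst.
    exact: expi2pi_eigenvalue_continuous.
  - by move=> yt; exact: norm_expi2pi.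
  - move=> [y t]; have [X10|X10] := eqVneq (X1 y) 0; first by left; exact: expi2pi_off_supp.
    right=> i j; pose u : set_type (mx_supp X1) := exist _ y (mem_set X10).
    pose F ut := rot V a N (set_val ut.2) (l (set_val (H ut))) i j : R[i]^o.
    apply: (@continuous_open_sub _ _ _ (mx_supp X1) F (fun yt => G yt i j : R[i]^o) u t).
    - exact: open_mx_supp.
    - by move=> u' t'; rewrite GE.
    - move=> ut; apply: rot_cvg => //.
        apply: (@continuous_comp _ _ _ (fun ut : set_type _ * unit_interval R => ut.2) set_val).
          exact: cvg_snd.
        exact: initial_continuous.
      move=> i' j'; have Hs : (set_val \o H) @ ut --> set_val (H ut).
        by apply: continuous_comp; [exact: Hc|exact: initial_continuous].
      have := left_support_cvg X1c X120 (set_mem (valP (H ut))) (i := i') (j := j').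
      exact: (@cvg_comp _ _ _ (set_val \o H) _ _ _ _ Hs).
move=> x t; split=> ht /=.
  have -> : 1%:M - G (x, t) + expi2pi (f x) *: G (x, t) = 1%:M - l x + expi2pi (f x) *: l x.
    have [X10|X10] := eqVneq (X1 x) 0; first by rewrite expi2pi_off_supp // !scale1r !subrK.
    have [Hx0 _] := H01 (exist _ x (mem_set X10)) t.
    by rewrite (GE (exist _ x (mem_set X10))) ht rot0 Hx0.
  by rewrite /castsq castmx_id dsum_empty.
have -> : 1%:M - G (x, t) + expi2pi (f x) *: G (x, t) =
    1%:M - delta_mx 0 0 + expi2pi (f x) *: delta_mx 0 0.
  have [X10|X10] := eqVneq (X1 x) 0; first by rewrite expi2pi_off_supp // !scale1r !subrK.
  have [_ Hx1] := H01 (exist _ x (mem_set X10)) t.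
  rewrite (GE (exist _ x (mem_set X10))) ht rot1 // Hx1 // VpV scalerA -rmorphM /=.
  by rewrite mulVf ?gt_eqF // scale1r.
apply/matrixP => i j; rewrite /dsum.
case: (split_ordP i) => i' ->; case: (split_ordP j) => j' ->; rewrite (ord1 i') (ord1 j').
- by rewrite block_mxEul !mxE /= !mulr1n mulr1 subrr add0r.
- by rewrite block_mxEur !mxE /= !mulr0n mulr0 subr0 addr0.
- by rewrite block_mxEdl !mxE /= !mulr0n mulr0 subr0 addr0.
- by rewrite block_mxEdr !mxE /= !mulr0n mulr0 subr0 addr0.
Qed.

End RieffelField.

Theorem theorem1p3 (R : realType) (Y : topologicalType)
    (X0 X1 : Y -> 'M[R[i]]_2)
    (Y_compact : compact [set: Y])
    (X0_continuous : mx_continuous X0)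
    (X1_continuous : mx_continuous X1)
    (X0_selfadjoint : forall y, X0 y = (X0 y)^t*)
    (P_projection : is_projection_over (rieffel X0 X1))
    (P_nontrivial : exists y, X1 y != 0)
    (P_rank1 : forall y z, \rank (rieffel X0 X1 (y, z)) = 1%N) :
  exists f : Y -> R,
    (forall y, 0 <= f y <= 1) /\
    {within mx_supp X1, continuous f} /\
    (forall y, ~ mx_supp X1 y -> f y = 0) /\
    (forall y, X0 y *m left_support (X1 y) = (f y)%:C *: left_support (X1 y)) /\
    continuous (fun y => expi2pi (f y) : R[i]^o) /\
    (exists hu : is_unitary_over (fun y => (1%:M - left_support (X1 y))
                                      + expi2pi (f y) *: left_support (X1 y)),
      PV_boundary (K0_class (ProjectionOver P_projection)) (K1_class (UnitaryOver hu))) /\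
    (contractible R (set_type (mx_supp X1)) ->
      exists hv : is_unitary_over (fun y => (expi2pi (f y))%:M : 'M[R[i]]_1),
        PV_boundary (K0_class (ProjectionOver P_projection)) (K1_class (UnitaryOver hv))).
Proof.
have rel y : [/\ X1 y *m X1 y = 0, X0 y *m X1 y + X1 y *m X0 y = X1 y
    & X0 y *m X0 y + X1 y *m (X1 y)^t* + (X1 y)^t* *m X1 y = X0 y].
  apply: rieffel_relations => z z1; have [_ PP] := P_projection.
  by have [_] := PP (y, exist _ (z : R[i]^o) (mem_set z1)).
have r1 y : X1 y *m X1 y = 0 by case: (rel y).
have r2 y : X0 y *m X1 y + X1 y *m X0 y = X1 y by case: (rel y).
have r3 y : X0 y *m X0 y + X1 y *m (X1 y)^t* + (X1 y)^t* *m X1 y = X0 y by case: (rel y).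
exists (fun y => support_eigenvalue (X0 y) (X1 y)); split.
  by move=> y; exact: support_eigenvalue_le.
split.
  apply: continuous_in_subspaceT => y /set_mem; exact: eigenvalue_continuous_at.
split; first by move=> y /negP; rewrite negbK => /eqP; exact: support_eigenvalue0.
split; first by move=> y; exact: mul_eigen_left_support.
have ec := expi2pi_eigenvalue_continuous X0_continuous X1_continuous X0_selfadjoint r1 r2 r3.
split; first exact: ec.
split.
  exists (rieffel_unitary X0_continuous X1_continuous X0_selfadjoint r1 r2 r3).
  by apply: PV_boundary_rieffel; exact: K1_eq_refl.
move=> supp_contr.
have hv : is_unitary_over (fun y => (expi2pi (support_eigenvalue (X0 y) (X1 y)))%:M : 'M[R[i]]_1).
  split=> [i j|y].
    rewrite (ord1 i) (ord1 j).
    by under eq_fun do rewrite mxE eqxx mulr1n; exact: ec.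
  apply/unitarymxP; rewrite tr_scalar_mx map_scalar_mx -scalar_mxM /=.
  by rewrite -normCK norm_expi2pi expr1n.
exists hv; apply: PV_boundary_rieffel; exact: K1_eq_contractible_supp.
Qed.
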